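(* Let $L\to N$ be a quasiisomorphism of differential graded Lie algebras over a field $\mathbb{K}$ of characteristic $0$ (i.e. a morphism of differential graded Lie algebras inducing an isomorphism in cohomology). Then the induced morphism of functors $\mathrm{Def}_L\to\mathrm{Def}_N$ is an isomorphism.
   Context: A differential graded Lie algebra is a $\mathbb{Z}$-graded vector space $L=\oplus_i L^i$ with a homogeneous graded-skewsymmetric bracket satisfying the graded Jacobi identity and a differential $d$ of degree $+1$ that is a derivation of the bracket. $\mathrm{Art}_{\mathbb{K}}$ is the category of local Artinian $\mathbb{K}$-algebras with residue field $\mathbb{K}$; $\mathfrak{m}_A$ is the maximal ideal of $A$. For $A\in\mathrm{Art}_{\mathbb{K}}$ put $MC_L(A)=\{x\in L^1\otimes\mathfrak{m}_A\mid dx+\frac12[x,x]=0\}$. The group $\exp(L^0\otimes\mathfrak{m}_A)$ (the nilpotent Lie algebra $L^0\otimes\mathfrak{m}_A$ with the Baker-Campbell-Hausdorff product) acts on $MC_L(A)$ by $\exp(a)(x)=x+\sum_{n\ge 0}\frac{\mathrm{ad}(a)^n}{(n+1)!}([a,x]-da)$ (gauge action), and $\mathrm{Def}_L(A)$ is the quotient set. This defines a functor $\mathrm{Def}_L\colon\mathrm{Art}_{\mathbb{K}}\to\mathrm{Set}$, functorial in $L$. *)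

(* Defs.v *)
From HB Require Import structures.
From mathcomp Require Import all_boot all_algebra generic_quotient ring_quotient.
From mathcomp Require Import finmap boolp classical_sets fsbigop.
From mathcomp Require Import monalg.

Set Implicit Arguments.
Unset Strict Implicit.
Unset Printing Implicit Defensive.

Import GRing.Theory.
Local Open Scope ring_scope.
Local Open Scope quotient_scope.
Local Open Scope classical_set_scope.

(** * Quotient of a vector space by a subspace *)

Section QuotientModule.
Variables (K : fieldType) (V : lmodType K) (S : submodClosed V).

Definition subspace_pred : V -> bool := fun x => x \in S.

Fact subspace_zmod_closed : zmod_closed subspace_pred.
Proof. exact: (submodClosedP S : zmod_closed _). Qed.

HB.instance Definition _ :=
  GRing.isZmodClosed.Build V subspace_pred subspace_zmod_closed.

Definition quotmod : Type :=
  Quotient.quot (GRing.ZmodClosed.clone V subspace_pred _).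
HB.instance Definition _ := ZmodQuotient.on quotmod.

Definition quotmod_pi (x : V) : quotmod := \pi_quotmod x.
Definition quotmod_repr (v : quotmod) : V := repr v.

Lemma quotmod_reprK : cancel quotmod_repr quotmod_pi.
Proof. exact: reprK. Qed.

Lemma quotmod_piP (x y : V) : quotmod_pi x = quotmod_pi y <-> x - y \in S.
Proof.
rewrite (_ : (x - y \in S) = (quotmod_pi x == quotmod_pi y)); first last.
  by rewrite /quotmod_pi piE.
by split=> /eqP.
Qed.

Fact quotmod_pi_additive : zmod_morphism quotmod_pi.
Proof. exact: pi_is_zmod_morphism. Qed.
HB.instance Definition _ :=
  GRing.isZmodMorphism.Build V quotmod quotmod_pi quotmod_pi_additive.

Definition quotmod_scale (c : K) (v : quotmod) : quotmod :=
  quotmod_pi (c *: quotmod_repr v).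

Lemma quotmod_scaleE c x : quotmod_scale c (quotmod_pi x) = quotmod_pi (c *: x).
Proof.
apply/quotmod_piP; rewrite -scalerBr rpredZ //.
by apply/quotmod_piP; rewrite quotmod_reprK.
Qed.

Fact quotmod_scaleA a b v :
  quotmod_scale a (quotmod_scale b v) = quotmod_scale (a * b) v.
Proof. by rewrite -[v]quotmod_reprK !quotmod_scaleE scalerA. Qed.
Fact quotmod_scale1 : left_id 1 quotmod_scale.
Proof. by move=> v; rewrite -[v]quotmod_reprK quotmod_scaleE scale1r. Qed.
Fact quotmod_scaleDr : right_distributive quotmod_scale +%R.
Proof.
move=> c u v; rewrite -[u]quotmod_reprK -[v]quotmod_reprK.
by rewrite -raddfD !quotmod_scaleE -raddfD scalerDr.
Qed.
Fact quotmod_scaleDl v : {morph quotmod_scale^~ v : a b / a + b}.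
Proof.
by move=> a b; rewrite -[v]quotmod_reprK !quotmod_scaleE scalerDl raddfD.
Qed.
HB.instance Definition _ := GRing.Zmodule_isLmodule.Build K quotmod
  quotmod_scaleA quotmod_scale1 quotmod_scaleDr quotmod_scaleDl.

Fact quotmod_pi_scalable : scalable quotmod_pi.
Proof. by move=> c x; rewrite -quotmod_scaleE. Qed.
HB.instance Definition _ :=
  GRing.isScalable.Build K V quotmod *:%R quotmod_pi quotmod_pi_scalable.

End QuotientModule.

(** * Tensor product of vector spaces *)

Section Tensor.
Variables (K : fieldType) (V W : lmodType K).

Local Notation free := {malg K[(V * W)%type]}.

Inductive tensor_relation : free -> Prop :=
| TensorRelL c v v' w : tensor_relation
    (<< (c *: v + v', w) >> - c *: << (v, w) >> - << (v', w) >>)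
| TensorRelR c v w w' : tensor_relation
    (<< (v, c *: w + w') >> - c *: << (v, w) >> - << (v, w') >>).

Definition tensor_null : free -> bool := fun g =>
  `[< forall S : {pred free}, submod_closed S ->
        (forall r, tensor_relation r -> r \in S) -> g \in S >].

Fact tensor_null_submod_closed : submod_closed tensor_null.
Proof.
split; first by apply/asboolP=> S [].
move=> c g h /asboolP Sg /asboolP Sh; apply/asboolP => S clS rS.
by apply: clS.2; [exact: Sg | exact: Sh].
Qed.
HB.instance Definition _ :=
  GRing.isSubmodClosed.Build K free tensor_null tensor_null_submod_closed.

Definition tensor : Type :=
  quotmod (GRing.SubmodClosed.clone K free tensor_null _).
HB.instance Definition _ := GRing.Lmodule.on tensor.

Definition tens (v : V) (w : W) : tensor := quotmod_pi _ << (v, w) >>.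

Lemma tens_linear_l w : linear (tens^~ w).
Proof.
move=> c v v'; rewrite /tens -linearZ -linearD; apply/quotmod_piP.
apply/asboolP => S _; apply; rewrite opprD addrA; exact: TensorRelL.
Qed.

Lemma tens_linear_r v : linear (tens v).
Proof.
move=> c w w'; rewrite /tens -linearZ -linearD; apply/quotmod_piP.
apply/asboolP => S _; apply; rewrite opprD addrA; exact: TensorRelR.
Qed.

Lemma tensorE (t : tensor) : let g : free := quotmod_repr t in
  t = \sum_(p <- msupp g) g@_p *: tens p.1 p.2.
Proof.
rewrite /= -[t in LHS]quotmod_reprK [quotmod_repr t in LHS]monalgE linear_sum.
apply: eq_bigr => -[v w] _; rewrite /tens -linearZ; congr quotmod_pi.
by apply/malgP => p; rewrite mcoeffZ !mcoeffU mulrnAr mulr1.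
Qed.

Lemma eq_tensor (U : lmodType K) (f g : tensor -> U) : linear f -> linear g ->
  (forall v w, f (tens v w) = g (tens v w)) -> f =1 g.
Proof.
move=> fL gL fg t.
pose F : {linear tensor -> U} := HB.pack f (GRing.isLinear.Build _ _ _ _ f fL).
pose G : {linear tensor -> U} := HB.pack g (GRing.isLinear.Build _ _ _ _ g gL).
rewrite -[f]/(F : _ -> _) -[g]/(G : _ -> _) [t]tensorE !linear_sum.
by apply: eq_bigr => p _; rewrite !linearZ; congr (_ *: _); apply: fg.
Qed.

Section Lift.
Variable U : lmodType K.
Implicit Type b : V -> W -> U.

Definition bilinear_fun b :=
  (forall w, linear (b^~ w)) /\ (forall v, linear (b v)).

Definition free_lift b (g : free) : U :=
  \sum_(p <- msupp g) g@_p *: b p.1 p.2.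

(* The linear map V (x) W -> U determined by b; for b not bilinear its value
   depends on the chosen representative. *)
Definition tensor_lift b (t : tensor) : U := free_lift b (quotmod_repr t).

Lemma free_liftEw b g (D : {fset (V * W)%type}) : (msupp g `<=` D)%fset ->
  free_lift b g = \sum_(p <- D) g@_p *: b p.1 p.2.
Proof.
move=> sgD; apply: big_fset_incl => // p _; rewrite -mcoeff_eq0 => /eqP->.
exact: scale0r.
Qed.

Lemma free_lift_linear b : linear (free_lift b).
Proof.
move=> c g h; pose D := (msupp (c *: g + h) `|` msupp g `|` msupp h)%fset.
rewrite !(@free_liftEw _ _ D) /D; first 1 last.
- exact: fsubsetUr.
- by rewrite -fsetUA fsetUCA fsubsetUl.
- by rewrite -fsetUA fsubsetUl.
rewrite scaler_sumr -big_split /=; apply: eq_bigr => p _.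
by rewrite mcoeffD mcoeffZ scalerDl scalerA.
Qed.
HB.instance Definition _ b :=
  GRing.isLinear.Build K free U *:%R (free_lift b) (free_lift_linear b).

Lemma free_liftU b v w : free_lift b << (v, w) >> = b v w.
Proof.
rewrite (@free_liftEw _ _ [fset (v, w)]%fset) ?msuppU_le //.
by rewrite big_seq_fset1 mcoeffUU scale1r.
Qed.

Lemma free_lift_null b g : bilinear_fun b -> tensor_null g ->
  free_lift b g = 0.
Proof.
move=> [bl br] /asboolP/(_ [pred h | free_lift b h == 0]) H.
apply/eqP; apply: H.
  split=> [|c x y /eqP x0 /eqP y0]; first by rewrite inE linear0.
  by rewrite inE free_lift_linear x0 y0 scaler0 addr0.
move=> _ [c v v' w|c v w w']; rewrite inE -addrA -opprD linearB subr_eq0.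
  by rewrite linearD linearZ /= !free_liftU; apply/eqP/bl.
by rewrite linearD linearZ /= !free_liftU; apply/eqP/br.
Qed.

Lemma tensor_lift_pi b g : bilinear_fun b ->
  tensor_lift b (quotmod_pi _ g) = free_lift b g.
Proof.
move=> bb; apply/eqP; rewrite -subr_eq0 -linearB; apply/eqP.
by apply: free_lift_null => //; apply/quotmod_piP; rewrite quotmod_reprK.
Qed.

Lemma tensor_lift_tens b v w : bilinear_fun b -> tensor_lift b (tens v w) = b v w.
Proof. by move=> bb; rewrite tensor_lift_pi // free_liftU. Qed.

Lemma tensor_lift_linear b : bilinear_fun b -> linear (tensor_lift b).
Proof.
move=> bb c s t; rewrite -[s]quotmod_reprK -[t]quotmod_reprK -linearZ -linearD.
by rewrite !tensor_lift_pi // linearP.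
Qed.

Lemma tensor_lift_comb b b1 b2 c t :
  (forall v w, b v w = c *: b1 v w + b2 v w) ->
  tensor_lift b t = c *: tensor_lift b1 t + tensor_lift b2 t.
Proof.
move=> bE; rewrite scaler_sumr -big_split; apply: eq_bigr => p _.
by rewrite bE scalerDr !scalerA mulrC.
Qed.

End Lift.

End Tensor.

Section TensorMap.
Variables (K : fieldType) (V V' W W' : lmodType K).

Definition tensor_map (f : V -> V') (g : W -> W') :
    tensor V W -> tensor V' W' :=
  tensor_lift (fun v w => tens (f v) (g w)).

Variables (f : V -> V') (g : W -> W').
Hypotheses (fL : linear f) (gL : linear g).

Lemma tensor_map_bilinear : bilinear_fun (fun v w => tens (f v) (g w)).
Proof.
by split=> [w|v] c x y; rewrite (fL, gL) (tens_linear_l, tens_linear_r).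
Qed.

Lemma tensor_map_linear : linear (tensor_map f g).
Proof. exact: tensor_lift_linear tensor_map_bilinear. Qed.

Lemma tensor_map_tens v w : tensor_map f g (tens v w) = tens (f v) (g w).
Proof. exact: tensor_lift_tens tensor_map_bilinear. Qed.

End TensorMap.

(** * Local Artinian K-algebras with residue field K *)

Section Ideals.
Variables (K : fieldType) (A : comAlgType K).

Definition ideal (I : set A) :=
  [/\ I 0, forall x y, I x -> I y -> I (x + y) & forall a x, I x -> I (a * x)].

Definition maximal_ideal (M : set A) :=
  [/\ ideal M, M <> setT &
      forall J, ideal J -> M `<=` J -> J = M \/ J = setT].

Definition artinian :=
  forall I : nat -> set A, (forall n, ideal (I n)) ->
    (forall n, I n.+1 `<=` I n) -> exists N, forall n, (N <= n)%N -> I n = I N.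

End Ideals.

Record artAlg (K : fieldType) := ArtAlg {
  art_sort :> comAlgType K;
  art_max : set art_sort;
  artP : artinian art_sort;
  art_maxP : maximal_ideal art_max;
  art_max_uniq : forall J, maximal_ideal J -> J = art_max;
  (* the residue map K -> A / m is bijective *)
  art_residue : forall a : art_sort, exists! c : K, art_max (a - c%:A)
}.

Section MaximalIdeal.
Variables (K : fieldType) (A : artAlg K).

Definition maxid_pred : A -> bool := fun a => `[< art_max a >].

Fact maxid_submod_closed : submod_closed maxid_pred.
Proof.
have [[m0 mD mM] _ _] := art_maxP A.
split=> [|c x y /asboolP mx /asboolP my]; apply/asboolP => //.
by rewrite -mulr_algl; apply: mD => //; apply: mM.
Qed.
HB.instance Definition _ :=
  GRing.isSubmodClosed.Build K A maxid_pred maxid_submod_closed.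

Record maxid := Maxid { maxid_val : A; maxid_valP : maxid_val \in maxid_pred }.
HB.instance Definition _ := [isSub for maxid_val].
HB.instance Definition _ := [Choice of maxid by <:].
HB.instance Definition _ := [SubChoice_isSubLmodule of maxid by <:].

Fact maxid_mul_subproof (a b : maxid) : maxid_val a * maxid_val b \in maxid_pred.
Proof.
have [[_ _ mM] _ _] := art_maxP A.
by apply/asboolP/mM/asboolP; exact: (maxid_valP b).
Qed.
Definition maxid_mul (a b : maxid) : maxid := Maxid (maxid_mul_subproof a b).

End MaximalIdeal.

(* K-algebra morphisms between objects of Art_K are automatically local. *)
Lemma art_hom_local (K : fieldType) (A B : artAlg K) (g : {lrmorphism A -> B})
  (a : maxid A) : g (maxid_val a) \in @maxid_pred K B.
Proof.
have [[m0 mD mM] mT _] := art_maxP B.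
have m1 : ~ art_max (1 : B).
  move=> m1; apply: mT; apply/seteqP; split=> // x _.
  by rewrite -[x]mulr1; apply: mM.
suff maxJ : maximal_ideal [set x : A | art_max (g x)].
  have /asboolP := maxid_valP a; rewrite -(art_max_uniq maxJ) => ma.
  exact/asboolP.
split.
- split=> [|x y /= mx my|x y /= my].
  + by rewrite /= linear0.
  + by rewrite linearD; apply: mD.
  + by rewrite rmorphM; apply: mM.
- move=> JT; apply: m1; rewrite -(rmorph1 g).
  by have : [set: A] 1 by []; rewrite -JT.
- move=> I [I0 ID IM] JI; have [IJ|] := pselect (I `<=` [set x | art_max (g x)]).
    by left; apply/seteqP.
  move=> /existsNP[x /not_implyP[Ix /= nmx]]; right.
  have [c [mc _]] := art_residue (g x).
  have c0 : c != 0.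
    by apply/eqP => c0; apply: nmx; move: mc; rewrite c0 scale0r subr0.
  have Ixc : I (x - c%:A) by apply: JI; rewrite /= linearB linearZ rmorph1.
  have Ic : I c%:A.
    rewrite -[_%:A](subKr x); apply: ID => //.
    by rewrite -mulN1r; apply: IM.
  apply/seteqP; split=> // y _.
  have -> : y = (y * c^-1%:A) * c%:A.
    by rewrite -mulrA -scalerAl mul1r scalerA mulVf // scale1r mulr1.
  exact: IM.
Qed.

Definition maxid_map (K : fieldType) (A B : artAlg K) (g : {lrmorphism A -> B})
  (a : maxid A) : maxid B := Maxid (art_hom_local g a).

(** * Differential graded Lie algebras *)

(* The bracket and the differential are indexed by proofs of the degree
   equations, so that no transport along equalities of degrees is needed;
   such proofs are unique because equality on int is decidable. *)
Record dgla (K : fieldType) := DGLA {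
  dg_sort :> int -> lmodType K;
  dbr : forall i j k : int, i + j = k -> dg_sort i -> dg_sort j -> dg_sort k;
  ddiff : forall i j : int, i + 1 = j -> dg_sort i -> dg_sort j;
  dbr_linear_l : forall (i j k : int) (e : i + j = k) y,
    linear (fun x => dbr e x y);
  dbr_linear_r : forall (i j k : int) (e : i + j = k) x, linear (dbr e x);
  dbr_skew : forall (i j k : int) (e : i + j = k) (e' : j + i = k) x y,
    dbr e x y = - ((-1) ^+ absz (i * j) *: dbr e' y x);
  dbr_jacobi : forall (i j k ij jk ik l : int)
      (eij : i + j = ij) (ejk : j + k = jk) (eik : i + k = ik)
      (e1 : i + jk = l) (e2 : ij + k = l) (e3 : j + ik = l) x y z,
    dbr e1 x (dbr ejk y z) =
    dbr e2 (dbr eij x y) z + (-1) ^+ absz (i * j) *: dbr e3 y (dbr eik x z);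
  ddiff_linear : forall (i j : int) (e : i + 1 = j), linear (ddiff e);
  ddiff_ddiff : forall (i j k : int) (e : i + 1 = j) (e' : j + 1 = k) x,
    ddiff e' (ddiff e x) = 0;
  ddiff_dbr : forall (i j k i' j' k' : int) (e : i + j = k)
      (ei : i + 1 = i') (ej : j + 1 = j') (ek : k + 1 = k')
      (e1 : i' + j = k') (e2 : i + j' = k') x y,
    ddiff ek (dbr e x y) =
    dbr e1 (ddiff ei x) y + (-1) ^+ absz i *: dbr e2 x (ddiff ej y)
}.

Record dglaHom (K : fieldType) (L N : dgla K) := DGLAHom {
  dg_map :> forall i, L i -> N i;
  dg_map_linear : forall i, linear (dg_map (i := i));
  dg_map_br : forall (i j k : int) (e : i + j = k) x y,
    dg_map (dbr e x y) = dbr e (dg_map x) (dg_map y);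
  dg_map_diff : forall (i j : int) (e : i + 1 = j) x,
    dg_map (ddiff e x) = ddiff e (dg_map x)
}.

Definition dgla_id (K : fieldType) (L : dgla K) : dglaHom L L :=
  @DGLAHom K L L (fun i x => x) (fun i c x y => erefl)
    (fun i j k e x y => erefl) (fun i j e x => erefl).

(** * Cohomology *)

Section Cohomology.
Variables (K : fieldType) (L : dgla K) (i : int).

Definition cocycle_pred : L i -> bool := fun x => ddiff (erefl (i + 1)) x == 0.

Fact cocycle_submod_closed : submod_closed cocycle_pred.
Proof.
have dL := @ddiff_linear K L i _ erefl.
pose d : {linear L i -> L (i + 1)} := HB.pack (@ddiff K L i _ erefl)
  (GRing.isLinear.Build _ _ _ _ _ dL).
split; first exact/eqP/(linear0 d).
by move=> c x y /eqP dx /eqP dy; apply/eqP; rewrite dL dx dy scaler0 addr0.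
Qed.
HB.instance Definition _ :=
  GRing.isSubmodClosed.Build K (L i) cocycle_pred cocycle_submod_closed.

Record cocycle := Cocycle { cocycle_val : L i;
  cocycle_valP : cocycle_val \in cocycle_pred }.
HB.instance Definition _ := [isSub for cocycle_val].
HB.instance Definition _ := [Choice of cocycle by <:].
HB.instance Definition _ := [SubChoice_isSubLmodule of cocycle by <:].

Definition coboundary_pred : cocycle -> bool := fun z =>
  `[< exists y : L (i - 1), ddiff (subrK 1 i) y = cocycle_val z >].

Fact coboundary_submod_closed : submod_closed coboundary_pred.
Proof.
have dL := @ddiff_linear K L _ _ (subrK 1 i).
pose d : {linear L (i - 1) -> L i} := HB.pack (@ddiff K L _ _ (subrK 1 i))
  (GRing.isLinear.Build _ _ _ _ _ dL).
split; first by apply/asboolP; exists 0; exact: (linear0 d).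
move=> c x y /asboolP[x' dx] /asboolP[y' dy]; apply/asboolP.
by exists (c *: x' + y'); rewrite dL dx dy.
Qed.
HB.instance Definition _ :=
  GRing.isSubmodClosed.Build K cocycle coboundary_pred coboundary_submod_closed.

Definition cohomology : Type :=
  quotmod (GRing.SubmodClosed.clone K cocycle coboundary_pred _).
HB.instance Definition _ := GRing.Lmodule.on cohomology.

Definition coh_class (z : cocycle) : cohomology := quotmod_pi _ z.

End Cohomology.

Section CohomologyMap.
Variables (K : fieldType) (L N : dgla K) (f : dglaHom L N) (i : int).

Fact cocycle_map_subproof (z : cocycle L i) : f i (cocycle_val z) \in @cocycle_pred K N i.
Proof.
have dL := @dg_map_linear K L N f (i + 1).
pose g : {linear L (i + 1) -> N (i + 1)} := HB.pack (@dg_map _ _ _ f (i + 1))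
  (GRing.isLinear.Build _ _ _ _ _ dL).
have /eqP dz := cocycle_valP z.
by apply/eqP; rewrite -dg_map_diff dz; exact: (linear0 g).
Qed.

Definition cocycle_map (z : cocycle L i) : cocycle N i :=
  Cocycle (cocycle_map_subproof z).

Definition coh_map (h : cohomology L i) : cohomology N i :=
  coh_class (cocycle_map (quotmod_repr h)).

Lemma coh_map_class z : coh_map (coh_class z) = coh_class (cocycle_map z).
Proof.
apply/quotmod_piP/asboolP.
have /quotmod_piP/asboolP[y dy] := quotmod_reprK (coh_class z).
exists (f _ y); rewrite -dg_map_diff dy /=.
have fL := @dg_map_linear K L N f i.
pose g : {linear L i -> N i} := HB.pack (@dg_map _ _ _ f i)
  (GRing.isLinear.Build _ _ _ _ _ fL).
exact: (linearB g).
Qed.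

Lemma coh_map_linear : linear coh_map.
Proof.
move=> c h h'; rewrite -[h]quotmod_reprK -[h']quotmod_reprK.
have -> (z z' : cocycle L i) : c *: quotmod_pi _ z + quotmod_pi _ z' =
    coh_class (c *: z + z') by rewrite /coh_class linearP.
rewrite !(coh_map_class (quotmod_repr _)) coh_map_class.
rewrite [in RHS]/coh_class -[RHS]linearP; congr coh_class.
by apply: val_inj; rewrite /= dg_map_linear.
Qed.

End CohomologyMap.

Definition quasi_isomorphism (K : fieldType) (L N : dgla K) (f : dglaHom L N) :=
  forall i, bijective (@coh_map K L N f i).

(** * The deformation functor *)

Section TensorDGLA.
Variables (K : fieldType) (L : dgla K) (A : artAlg K).

(* L^i (x) m_A, with the differential d (x) id and the bracket
   [x (x) a, y (x) b] = [x, y] (x) ab. *)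
Definition Lm (i : int) : lmodType K := tensor (L i) (maxid A).

Definition tdiff (i j : int) (e : i + 1 = j) : Lm i -> Lm j :=
  tensor_map (ddiff e) id.

Definition tbr (i j k : int) (e : i + j = k) (u : Lm i) (v : Lm j) : Lm k :=
  tensor_lift (fun (x : L i) (a : maxid A) =>
    tensor_lift (fun (y : L j) (b : maxid A) =>
      tens (dbr e x y) (maxid_mul a b)) v) u.

Lemma maxid_mul_linear_l (b : maxid A) : linear (@maxid_mul K A ^~ b).
Proof. by move=> c x y; apply: val_inj; rewrite /= mulrDl scalerAl. Qed.
Lemma maxid_mul_linear_r (a : maxid A) : linear (@maxid_mul K A a).
Proof. by move=> c x y; apply: val_inj; rewrite /= mulrDr scalerAr. Qed.

Section Bracket.
Variables (i j k : int) (e : i + j = k).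

Lemma tbr_bilinear_r (x : L i) (a : maxid A) :
  bilinear_fun (fun (y : L j) b => tens (dbr e x y) (maxid_mul a b)).
Proof.
split=> [b|y] c u v; first by rewrite dbr_linear_r tens_linear_l.
by rewrite maxid_mul_linear_r tens_linear_r.
Qed.

Lemma tbr_bilinear_l (v : Lm j) :
  bilinear_fun (fun (x : L i) (a : maxid A) =>
    tensor_lift (fun y b => tens (dbr e x y) (maxid_mul a b)) v).
Proof.
split=> [a|x] c u u'; apply: tensor_lift_comb => y b.
  by rewrite dbr_linear_l tens_linear_l.
by rewrite maxid_mul_linear_l tens_linear_r.
Qed.

Lemma tbr_linear_l v : linear (tbr e ^~ v).
Proof. exact: tensor_lift_linear (tbr_bilinear_l v). Qed.

Lemma tbr_linear_r u : linear (tbr e u).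
Proof.
move=> c v v'; apply: tensor_lift_comb => x a.
exact: tensor_lift_linear (tbr_bilinear_r x a) c v v'.
Qed.

Lemma tbr_tens x a y b :
  tbr e (tens x a) (tens y b) = tens (dbr e x y) (maxid_mul a b).
Proof.
rewrite /tbr (tensor_lift_tens _ _ (tbr_bilinear_l _)).
exact: tensor_lift_tens (tbr_bilinear_r x a).
Qed.

End Bracket.

Definition mc_eq (x : Lm 1) : Prop :=
  tdiff (erefl : 1 + 1 = 2 :> int) x
  + (2%:R)^-1 *: tbr (erefl : 1 + 1 = 2 :> int) x x = 0.

Definition MC : Type := {x : Lm 1 | mc_eq x}.

(* exp(a)(x) = x + \sum_n ad(a)^n / (n + 1)! ([a, x] - d a); the sum over all
   natural numbers n is a finitely supported one. *)
Definition gauge (a : Lm 0) (x : Lm 1) : Lm 1 :=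
  let ad := tbr (add0r 1 : 0 + 1 = 1 :> int) a in
  x + \sum_(n \in [set: nat]) (n.+1`!%:R : K)^-1 *:
        iter n ad (ad x - tdiff (add0r 1 : 0 + 1 = 1 :> int) a).

(* The orbit of x under exp(L^0 (x) m_A) as a subset of MC_L(A). It only involves
   the underlying set L^0 (x) m_A of that group, not the
   Baker-Campbell-Hausdorff product. *)
Definition gauge_orbit (x : MC) : set MC :=
  [set y | exists a, gauge a (sval x) = sval y].

Definition Def : Type := {C : set MC | exists x, gauge_orbit x = C}.

Definition Def_class (x : MC) : Def :=
  exist _ (gauge_orbit x) (ex_intro _ x erefl).

Definition Def_repr (C : Def) : MC := sval (cid (svalP C)).

Lemma Def_reprK : cancel Def_repr Def_class.
Proof.
case=> C p; rewrite /Def_repr /Def_class; case: cid => x /= xC.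
by case: C / xC p => p; congr exist; exact: Prop_irrelevance.
Qed.

End TensorDGLA.

Section Functoriality.
Variables (K : fieldType) (L N : dgla K) (A B : artAlg K).
Variables (f : dglaHom L N) (g : {lrmorphism A -> B}).

Definition Lm_map (i : int) : Lm L A i -> Lm N B i :=
  tensor_map (f i) (maxid_map g).

Lemma maxid_map_linear : linear (maxid_map g).
Proof. by move=> c a b; apply: val_inj; rewrite /= linearP. Qed.

Lemma Lm_map_linear (i : int) : linear (@Lm_map i).
Proof. exact: tensor_map_linear (dg_map_linear f (i := i)) maxid_map_linear. Qed.

Lemma Lm_map_tens (i : int) (x : L i) a :
  @Lm_map i (tens x a) = tens (f i x) (maxid_map g a).
Proof.
exact: tensor_map_tens (dg_map_linear f (i := i)) maxid_map_linear _ _.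
Qed.

Lemma Lm_map_tdiff (i j : int) (e : i + 1 = j) (u : Lm L A i) :
  Lm_map (tdiff e u) = tdiff e (Lm_map u).
Proof.
have dL M C := tensor_map_linear (@ddiff_linear K M i j e)
  ((fun c x y => erefl) : linear (@id (maxid C))).
have dT M C := tensor_map_tens (@ddiff_linear K M i j e)
  ((fun c x y => erefl) : linear (@id (maxid C))).
move: u; apply: eq_tensor => [c u v|c u v|x a].
- by rewrite [tdiff e _]dL Lm_map_linear.
- by rewrite Lm_map_linear [tdiff e _]dL.
- by rewrite [tdiff e _]dT !Lm_map_tens [tdiff e _]dT dg_map_diff.
Qed.

Lemma Lm_map_tbr (i j k : int) (e : i + j = k) (u : Lm L A i) (v : Lm L A j) :
  Lm_map (tbr e u v) = tbr e (Lm_map u) (Lm_map v).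
Proof.
move: u; apply: eq_tensor => [c u u'|c u u'|x a].
- by rewrite tbr_linear_l Lm_map_linear.
- by rewrite Lm_map_linear tbr_linear_l.
move: v; apply: eq_tensor => [c v v'|c v v'|y b].
- by rewrite tbr_linear_r Lm_map_linear.
- by rewrite Lm_map_linear tbr_linear_r.
rewrite tbr_tens !Lm_map_tens tbr_tens dg_map_br; congr tens.
by apply: val_inj; rewrite /= rmorphM.
Qed.

Fact MC_map_subproof (x : MC L A) : mc_eq (Lm_map (sval x)).
Proof.
pose h : {linear Lm L A 2 -> Lm N B 2} := HB.pack (@Lm_map 2)
  (GRing.isLinear.Build _ _ _ _ _ (@Lm_map_linear 2)).
have := congr1 h (svalP x); rewrite linear0 linearD linearZ /=.
by rewrite Lm_map_tdiff Lm_map_tbr.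
Qed.

Definition MC_map (x : MC L A) : MC N B :=
  exist _ (Lm_map (sval x)) (MC_map_subproof x).

(* The map induced on gauge classes, defined through a representative; that it
   does not depend on the representative relies on the gauge action being a
   group action, and is part of Def_functorial and of the main statement. *)
Definition Def_map (C : Def L A) : Def N B := Def_class (MC_map (Def_repr C)).

End Functoriality.

(** * Functors Art_K -> Set and their isomorphisms *)

Record artFunctorData (K : fieldType) := ArtFunctorData {
  fobj :> artAlg K -> Type;
  fmap : forall A B : artAlg K, {lrmorphism A -> B} -> fobj A -> fobj B
}.

Definition functor_laws (K : fieldType) (F : artFunctorData K) :=
  (forall (A : artAlg K) (x : F A), fmap (idfun : {lrmorphism A -> A}) x = x) /\
  (forall (A B C : artAlg K) (g : {lrmorphism A -> B}) (h : {lrmorphism B -> C})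
     (x : F A), fmap (h \o g : {lrmorphism A -> C}) x = fmap h (fmap g x)).

Definition natural (K : fieldType) (F G : artFunctorData K)
    (phi : forall A : artAlg K, F A -> G A) :=
  forall (A B : artAlg K) (g : {lrmorphism A -> B}) (x : F A),
    phi B (fmap g x) = fmap g (phi A x).

Definition natural_isomorphism (K : fieldType) (F G : artFunctorData K)
    (phi : forall A : artAlg K, F A -> G A) :=
  natural phi /\
  exists psi : forall A : artAlg K, G A -> F A,
    natural psi /\ forall A, cancel (phi A) (psi A) /\ cancel (psi A) (phi A).

Definition Def_functor (K : fieldType) (L : dgla K) : artFunctorData K :=
  @ArtFunctorData K (Def L) (fun A B g => Def_map (dgla_id L) g).

Definition Def_functorial (K : fieldType) (L : dgla K) :=
  functor_laws (Def_functor L) /\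
  forall (A B : artAlg K) (g : {lrmorphism A -> B}) (x : MC L A),
    fmap (a := Def_functor L) g (Def_class x) =
    Def_class (MC_map (dgla_id L) g x).

Definition Def_mor (K : fieldType) (L N : dgla K) (f : dglaHom L N)
    (A : artAlg K) : Def_functor L A -> Def_functor N A :=
  Def_map f (idfun : {lrmorphism A -> A}).

(* Main.v *)
From HB Require Import structures.
Require Import Defs.
From mathcomp Require Import all_boot all_algebra.
From mathcomp Require Import boolp classical_sets functions fsbigop.
From mathcomp Require Import ring.

Set Implicit Arguments.
Unset Strict Implicit.
Unset Printing Implicit Defensive.

Import GRing.Theory.
Local Open Scope ring_scope.

(** The proof is the obstruction-theoretic induction of Goldman and Millson along
    the powers of the maximal ideal m of A, for the nilpotent dgla L (x) m.

    Surjectivity. Suppose that x in L^1 (x) m satisfies the Maurer-Cartan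
    equation modulo m^(k+1) and that its image is close, at that order, to a
    gauge transform of a given Maurer-Cartan element of N. The obstruction to
    improving x is a class in H^2(L) (x) m^(k+1)/m^(k+2) that dies in N, hence
    is zero by injectivity on H^2, and the remaining discrepancy, a class in
    H^1(N), is absorbed by surjectivity on H^1 and by a gauge transformation
    ([surj_step]).

    Injectivity. The stabilizers of Maurer-Cartan elements obstruct a direct
    induction, so the gauge transformation from f x to f x' is replaced with a
    polynomial path y(t) of Maurer-Cartan elements, flowing along a polynomial
    c(t) in N^0 (x) m with c(0) = 0: t y' = [c, y] - d c. When x' - x and c are of
    order k, the integral of c/t from 0 to 1 is compared, by injectivity on H^1
    and surjectivity on H^0, with the image of an element a of order k of
    L^0 (x) m, up to an exact element d u with u in N^(-1) (x) m. Replacing x by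
    its transform by a, adding to c the infinitesimal stabilizer
    d(t u) + [y, t u] of y, and transforming the path by some g(t) with
    g(0) = f a and g(1) = 0, gives a path of order k + 1 ([mc_inj_step]).

    Both steps work on graded pieces, where elements decompose along finitely
    many linear forms on m ([tfil_split]), so that the hypothesis on the
    cohomology of L and N applies to their contractions.

    That gauge equivalence is an equivalence relation is the only part of the
    Baker-Campbell-Hausdorff theorem needed. It is proved with formal power
    series ([ps M] is the dgla M[[t]]): a linear flow with zero initial value
    vanishes ([flow_eq0]), which gives the transformation of flow lines under the
    gauge action ([gact_flow]); and the equation c = (exp(ad g) - 1)/(ad g) (t g')
    can be solved for g, by iterating a contraction for the filtration
    ([magnus]). Hence a product of two exponentials, being the end point of a
    flow, is the exponential of g(1) ([gactM]). *)

(** * Linear identities in a module *)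

(** Formal linear expressions over a list of vectors; the tactic [lmod] below
    reflects an equation between such expressions into the equality of the
    coefficients of each vector. *)
Inductive lexp (R : Type) :=
  | LVar of nat | LZero | LAdd of lexp R & lexp R | LOpp of lexp R
  | LScale of R & lexp R.
Arguments LVar {R}.
Arguments LZero {R}.

Section LinearExpressions.
Variables (R : comNzRingType) (V : lmodType R).

Fixpoint lexp_eval (env : seq V) (e : lexp R) : V :=
  match e with
  | LVar n => nth 0 env n
  | LZero => 0
  | LAdd a b => lexp_eval env a + lexp_eval env b
  | LOpp a => - lexp_eval env a
  | LScale c a => c *: lexp_eval env a
  end.

Fixpoint lexp_coef (i : nat) (e : lexp R) : R :=
  match e with
  | LVar n => if eqn n i then 1 else 0
  | LZero => 0
  | LAdd a b => lexp_coef i a + lexp_coef i b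
  | LOpp a => - lexp_coef i a
  | LScale c a => c * lexp_coef i a
  end.

Lemma lexp_evalE env e :
  lexp_eval env e = \sum_(i < size env) lexp_coef i e *: nth 0 env i.
Proof.
elim: e => [n||a IHa b IHb|a IHa|c a IHa] /=.
- have [ltn|len] := ltnP n (size env).
    rewrite (bigD1 (Ordinal ltn)) //= big1 ?addr0 => [|i ni].
      by case: eqnP => // _; rewrite scale1r.
    case: eqnP => [ni'|_]; last exact: scale0r.
    by case/eqP: ni; apply/val_inj.
  rewrite nth_default // big1 // => i _; case: eqnP => [ni|_].
    by have := ltn_ord i; rewrite -ni ltnNge len.
  exact: scale0r.
- by rewrite big1 // => i _; rewrite scale0r.
- by rewrite IHa IHb -big_split; apply: eq_bigr => i _; rewrite scalerDl.
- by rewrite IHa -sumrN; apply: eq_bigr => i _; rewrite scaleNr.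
- by rewrite IHa scaler_sumr; apply: eq_bigr => i _; rewrite scalerA.
Qed.

Fixpoint lexp_eqs (n : nat) (a b : lexp R) : Prop :=
  if n is m.+1 then lexp_coef m a = lexp_coef m b /\ lexp_eqs m a b else True.

Lemma lexp_eqP env a b :
  lexp_eqs (size env) a b -> lexp_eval env a = lexp_eval env b.
Proof.
rewrite !lexp_evalE => ab; apply: eq_bigr => i _; congr (_ *: _).
elim: (size env) (val i) (ltn_ord i) ab => // n IH j; rewrite ltnS leq_eqVlt.
by case/orP=> [/eqP -> []|lt_jn [_]] //; apply: IH.
Qed.

End LinearExpressions.

Ltac lmod_index x env :=
  lazymatch env with
  | cons x _ => constr:(0%N)
  | cons _ ?e => let n := lmod_index x e in constr:(S n)
  end.
Ltac lmod_add x env :=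
  match env with
  | context [cons x _] => env
  | _ => constr:(cons x env)
  end.
Ltac lmod_env env t :=
  lazymatch t with
  | (?a + ?b)%R => let e := lmod_env env a in lmod_env e b
  | (- ?a)%R => lmod_env env a
  | (?c *: ?a)%R => lmod_env env a
  | (?a *+ ?n)%R => lmod_env env a
  | (0)%R => env
  | _ => lmod_add t env
  end.
Ltac lmod_quote R env t :=
  lazymatch t with
  | (?a + ?b)%R =>
    let x := lmod_quote R env a in let y := lmod_quote R env b in
    constr:(@LAdd R x y)
  | (- ?a)%R => let x := lmod_quote R env a in constr:(@LOpp R x)
  | (?c *: ?a)%R => let x := lmod_quote R env a in constr:(@LScale R c x)
  | (?a *+ ?n)%R =>
    let x := lmod_quote R env a in constr:(@LScale R (n%:R) x)
  | (0)%R => constr:(@LZero R)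
  | _ => let n := lmod_index t env in constr:(@LVar R n)
  end.

(* [lmod_with R tac] proves an equation between linear combinations with
   coefficients in R, calling tac on the equations between coefficients; [lmod]
   is the instance for coefficients in a commutative ring, with no division. *)
Ltac lmod_with R tac :=
  rewrite -?scaler_nat;
  lazymatch goal with
  | |- @eq ?V ?a ?b =>
    let env0 := lmod_env (@nil V) a in
    let env := lmod_env env0 b in
    let x := lmod_quote R env a in
    let y := lmod_quote R env b in
    apply: (@lexp_eqP _ _ env x y); cbn [size lexp_eqs lexp_coef eqn];
    repeat match goal with |- _ /\ _ => split; [by tac | ] end; exact I
  end.
Ltac lmod R := lmod_with R ltac:(ring).

(** * Calculus in a differential graded Lie algebra *)

Section DglaLinear.
Variables (K : fieldType) (L : dgla K).

Lemma linear_morph (V W : lmodType K) (h : V -> W) : linear h ->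
  [/\ h 0 = 0, {morph h : x y / x + y}, {morph h : x / - x} &
      forall c x, h (c *: x) = c *: h x].
Proof.
move=> hL; pose g : {linear V -> W} :=
  HB.pack h (GRing.isLinear.Build _ _ _ _ h hL).
split=> [|x y|x|c x]; first exact: (linear0 g).
- exact: (linearD g).
- exact: (linearN g).
- exact: (linearZ_LR g).
Qed.

Lemma linear_sumr (V W : lmodType K) (h : V -> W) (I : Type) (r : seq I)
    (P : pred I) (E : I -> V) : linear h ->
  h (\sum_(i <- r | P i) E i) = \sum_(i <- r | P i) h (E i).
Proof. by case/linear_morph=> h0 hD _ _; apply: big_morph. Qed.

Section Diff.
Variables (i j : int) (e : i + 1 = j).
Lemma ddiff0 : ddiff e 0 = 0 :> L j.
Proof. by case: (linear_morph (@ddiff_linear K L i j e)). Qed.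
Lemma ddiffD (x y : L i) : ddiff e (x + y) = ddiff e x + ddiff e y.
Proof. by case: (linear_morph (@ddiff_linear K L i j e)). Qed.
Lemma ddiffN (x : L i) : ddiff e (- x) = - ddiff e x.
Proof. by case: (linear_morph (@ddiff_linear K L i j e)). Qed.
Lemma ddiffZ c (x : L i) : ddiff e (c *: x) = c *: ddiff e x.
Proof. by case: (linear_morph (@ddiff_linear K L i j e)). Qed.
End Diff.

Section Bracket.
Variables (i j k : int) (e : i + j = k).
Lemma dbr0l (y : L j) : dbr e 0 y = 0.
Proof. by case: (linear_morph (@dbr_linear_l K L i j k e y)). Qed.
Lemma dbrDl (x x' : L i) (y : L j) : dbr e (x + x') y = dbr e x y + dbr e x' y.
Proof. by case: (linear_morph (@dbr_linear_l K L i j k e y)). Qed.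
Lemma dbrNl (x : L i) (y : L j) : dbr e (- x) y = - dbr e x y.
Proof. by case: (linear_morph (@dbr_linear_l K L i j k e y)). Qed.
Lemma dbrZl c (x : L i) (y : L j) : dbr e (c *: x) y = c *: dbr e x y.
Proof. by case: (linear_morph (@dbr_linear_l K L i j k e y)). Qed.
Lemma dbr0r (x : L i) : dbr e x 0 = 0.
Proof. by case: (linear_morph (@dbr_linear_r K L i j k e x)). Qed.
Lemma dbrDr (x : L i) (y y' : L j) : dbr e x (y + y') = dbr e x y + dbr e x y'.
Proof. by case: (linear_morph (@dbr_linear_r K L i j k e x)). Qed.
Lemma dbrNr (x : L i) (y : L j) : dbr e x (- y) = - dbr e x y.
Proof. by case: (linear_morph (@dbr_linear_r K L i j k e x)). Qed.
Lemma dbrZr c (x : L i) (y : L j) : dbr e x (c *: y) = c *: dbr e x y.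
Proof. by case: (linear_morph (@dbr_linear_r K L i j k e x)). Qed.
End Bracket.

Section Morphism.
Variables (N : dgla K) (f : dglaHom L N) (i : int).
Lemma dg_map0 : f i 0 = 0.
Proof. by case: (linear_morph (@dg_map_linear K L N f i)). Qed.
Lemma dg_mapD (x y : L i) : f i (x + y) = f i x + f i y.
Proof. by case: (linear_morph (@dg_map_linear K L N f i)). Qed.
Lemma dg_mapN (x : L i) : f i (- x) = - f i x.
Proof. by case: (linear_morph (@dg_map_linear K L N f i)). Qed.
Lemma dg_mapZ c (x : L i) : f i (c *: x) = c *: f i x.
Proof. by case: (linear_morph (@dg_map_linear K L N f i)). Qed.
End Morphism.

End DglaLinear.

(** A derivation of degree 0 of a dgla. *)
Record derivation (K : fieldType) (M : dgla K) := Derivation {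
  der :> forall i, M i -> M i;
  der_linear : forall i, linear (der (i := i));
  der_dbr : forall (i j k : int) (e : i + j = k) x y,
    der (dbr e x y) = dbr e (der x) y + dbr e x (der y);
  der_ddiff : forall (i j : int) (e : i + 1 = j) x,
    der (ddiff e x) = ddiff e (der x)
}.

(** ** The operations in low degrees *)

(* Fixing the degrees in the following definitions keeps the proofs of the
   degree equations out of all the computations. In the names, the digits are
   the degrees of the arguments, and m stands for -1. *)
Section LowDegree.
Variables (K : fieldType) (M : dgla K).

Definition ad (a : M 0) (i : int) (x : M i) : M i := dbr (add0r i) a x.
Definition dm : M (-1) -> M 0 := ddiff (addNr 1).
Definition d0 : M 0 -> M 1 := ddiff (add0r 1).
Definition d1 : M 1 -> M 2 := ddiff erefl.
Definition d2 : M 2 -> M 3 := ddiff erefl.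
Definition br1m : M 1 -> M (-1) -> M 0 := dbr erefl.
Definition br2m : M 2 -> M (-1) -> M 1 := dbr erefl.
Definition br11 : M 1 -> M 1 -> M 2 := dbr erefl.
Definition br12 : M 1 -> M 2 -> M 3 := dbr erefl.
Arguments ad a {i} x.

Section Ad.
Variable i : int.
Implicit Types (a b : M 0) (x y : M i).
Lemma ad0l x : ad 0 x = 0. Proof. exact: dbr0l. Qed.
Lemma adDl a b x : ad (a + b) x = ad a x + ad b x. Proof. exact: dbrDl. Qed.
Lemma adNl a x : ad (- a) x = - ad a x. Proof. exact: dbrNl. Qed.
Lemma adZl k a x : ad (k *: a) x = k *: ad a x. Proof. exact: dbrZl. Qed.
Lemma ad0r a : ad a (0 : M i) = 0. Proof. exact: dbr0r. Qed.
Lemma adDr a x y : ad a (x + y) = ad a x + ad a y. Proof. exact: dbrDr. Qed.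
Lemma adNr a x : ad a (- x) = - ad a x. Proof. exact: dbrNr. Qed.
Lemma adZr k a x : ad a (k *: x) = k *: ad a x. Proof. exact: dbrZr. Qed.

Lemma ad_ad a b x : ad a (ad b x) = ad (ad a b) x + ad b (ad a x).
Proof.
rewrite /ad (dbr_jacobi (add0r 0) _ (add0r i) _ (add0r i) (add0r i)).
by rewrite mul0r expr0 scale1r.
Qed.
End Ad.

Lemma ad_skew (a b : M 0) : ad a b = - ad b a.
Proof. by rewrite /ad (dbr_skew _ (add0r 0)) mul0r expr0 scale1r. Qed.

Lemma adxx (char2 : 2%:R != 0 :> K) (a : M 0) : ad a a = 0.
Proof.
apply: (scalerI char2); rewrite scaler0 scaler_nat mulr2n.
by rewrite {1}ad_skew addNr.
Qed.

Lemma dmD x y : dm (x + y) = dm x + dm y. Proof. exact: ddiffD. Qed.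
Lemma dmN x : dm (- x) = - dm x. Proof. exact: ddiffN. Qed.
Lemma dmZ k x : dm (k *: x) = k *: dm x. Proof. exact: ddiffZ. Qed.
Lemma d00 : d0 0 = 0. Proof. exact: ddiff0. Qed.
Lemma d0D x y : d0 (x + y) = d0 x + d0 y. Proof. exact: ddiffD. Qed.
Lemma d0N x : d0 (- x) = - d0 x. Proof. exact: ddiffN. Qed.
Lemma d0Z k x : d0 (k *: x) = k *: d0 x. Proof. exact: ddiffZ. Qed.
Lemma d10 : d1 0 = 0. Proof. exact: ddiff0. Qed.
Lemma d1D x y : d1 (x + y) = d1 x + d1 y. Proof. exact: ddiffD. Qed.
Lemma d1N x : d1 (- x) = - d1 x. Proof. exact: ddiffN. Qed.
Lemma d1Z k x : d1 (k *: x) = k *: d1 x. Proof. exact: ddiffZ. Qed.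
Lemma d2D x y : d2 (x + y) = d2 x + d2 y. Proof. exact: ddiffD. Qed.
Lemma d2N x : d2 (- x) = - d2 x. Proof. exact: ddiffN. Qed.
Lemma d2Z k x : d2 (k *: x) = k *: d2 x. Proof. exact: ddiffZ. Qed.

Lemma br11Dl x y z : br11 (x + y) z = br11 x z + br11 y z.
Proof. exact: dbrDl. Qed.
Lemma br11Nl x z : br11 (- x) z = - br11 x z. Proof. exact: dbrNl. Qed.
Lemma br11Zl k x z : br11 (k *: x) z = k *: br11 x z. Proof. exact: dbrZl. Qed.
Lemma br11Dr x y z : br11 x (y + z) = br11 x y + br11 x z.
Proof. exact: dbrDr. Qed.
Lemma br11Nr x z : br11 x (- z) = - br11 x z. Proof. exact: dbrNr. Qed.
Lemma br11Zr k x z : br11 x (k *: z) = k *: br11 x z. Proof. exact: dbrZr. Qed.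
Lemma br12Dr x y z : br12 x (y + z) = br12 x y + br12 x z.
Proof. exact: dbrDr. Qed.
Lemma br12Zr k x z : br12 x (k *: z) = k *: br12 x z. Proof. exact: dbrZr. Qed.
Lemma br2m0l v : br2m 0 v = 0. Proof. exact: dbr0l. Qed.
Lemma br2mDl x y v : br2m (x + y) v = br2m x v + br2m y v.
Proof. exact: dbrDl. Qed.
Lemma br2mZl k x v : br2m (k *: x) v = k *: br2m x v. Proof. exact: dbrZl. Qed.

Definition lowE := (ad0l, adDl, adNl, adZl, ad0r, adDr, adNr, adZr,
  dmD, dmN, dmZ, d00, d0D, d0N, d0Z, (d10, d1D, d1N, d1Z, d2D, d2N, d2Z),
  (br11Dl, br11Nl, br11Zl, br11Dr, br11Nr, br11Zr, br12Dr, br12Zr),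
  (br2m0l, br2mDl, br2mZl)).

Lemma br11C x y : br11 x y = br11 y x.
Proof. by rewrite /br11 (dbr_skew _ erefl) mulr1 expr1 scaleN1r opprK. Qed.

Lemma ad_br11 a x y : ad a (br11 x y) = br11 (ad a x) y + br11 x (ad a y).
Proof.
rewrite /ad (dbr_jacobi (add0r 1) _ (add0r 1) _ erefl erefl).
by rewrite mul0r expr0 scale1r.
Qed.

Lemma d0_dm v : d0 (dm v) = 0. Proof. exact: ddiff_ddiff. Qed.
Lemma d1_d0 a : d1 (d0 a) = 0. Proof. exact: ddiff_ddiff. Qed.
Lemma d2_d1 x : d2 (d1 x) = 0. Proof. exact: ddiff_ddiff. Qed.

Lemma d0_ad a b : d0 (ad a b) = ad a (d0 b) - ad b (d0 a).
Proof.
rewrite /d0 /ad (ddiff_dbr (add0r 0) (add0r 1) (add0r 1) _ (addr0 1) (add0r 1)).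
by rewrite expr0 scale1r (dbr_skew _ (add0r 1)) mulr0 expr0 scale1r addrC.
Qed.

Lemma d1_ad a x : d1 (ad a x) = br11 (d0 a) x + ad a (d1 x).
Proof.
by rewrite /d1 /ad (ddiff_dbr _ (add0r 1) (erefl : 1 + 1 = 2%Z) _
  (erefl : 1 + 1 = 2%Z) (add0r 2)) expr0 scale1r.
Qed.

Lemma d2_br11 x y : d2 (br11 x y) = - br12 y (d1 x) - br12 x (d1 y).
Proof.
rewrite /d2 /br11 (ddiff_dbr _ (erefl : 1 + 1 = 2%Z) (erefl : 1 + 1 = 2%Z) _
  (erefl : 2%Z + 1 = 3%Z) (erefl : 1 + 2%Z = 3%Z)) expr1 scaleN1r.
rewrite (dbr_skew (erefl : 2%Z + 1 = 3%Z) (erefl : 1 + 2%Z = 3%Z)) mulr1 sqrrN.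
by rewrite expr1n scale1r.
Qed.

Hypothesis char0 : [pchar K] =i pred0.

Lemma natK_neq0 n : n.+1%:R != 0 :> K.
Proof. by rewrite (pcharf0P K).1. Qed.

Lemma two_neq0 : 2%:R != 0 :> K. Proof. exact: natK_neq0. Qed.

Lemma br12_br11 x : br12 x (br11 x x) = 0.
Proof.
have := @dbr_jacobi _ M 1 1 1 2%Z 2%Z 2%Z 3%Z erefl erefl erefl erefl erefl erefl x x x.
rewrite -/(br11 x x) (dbr_skew _ (erefl : 1 + 2%Z = 3%Z)) -/(br12 x (br11 x x)).
rewrite mulr1 sqrrN expr1n scale1r mulr1 expr1 scaleN1r => E.
have h3 : 3%:R != 0 :> K by exact: natK_neq0.
apply: (scalerI h3); rewrite scaler0.
set t := br12 _ _ in E *; transitivity (t - (- t - t)).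
  by lmod (K : Type).
by rewrite -E subrr.
Qed.

(** The curvature of an element of degree 1, whose vanishing is the
    Maurer-Cartan equation. *)
Definition curv (x : M 1) : M 2 := d1 x + 2%:R^-1 *: br11 x x.

Lemma curvD x z :
  curv (x + z) = curv x + d1 z + br11 x z + 2%:R^-1 *: br11 z z.
Proof.
have h := two_neq0; rewrite /curv !lowE (br11C z x).
by lmod_with (K : Type) ltac:(field).
Qed.

(** The Bianchi identity. *)
Lemma d2_curv x : d2 (curv x) = - br12 x (curv x).
Proof.
have h := two_neq0.
rewrite /curv !lowE d2_d1 br12_br11 d2_br11.
by lmod_with (K : Type) ltac:(field).
Qed.

(** The twisted differential d + [y, -] of a Maurer-Cartan element y squares to
    zero; thus the infinitesimal gauge transformations given by its exact
    elements fix y. *)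
Lemma twisted_exact_stab y v : curv y = 0 ->
  ad (dm v + br1m y v) y = d0 (dm v + br1m y v).
Proof.
have h := two_neq0.
move=> cy; rewrite !lowE d0_dm add0r.
have := @dbr_jacobi _ M 1 1 (-1) 2%Z 0 0 1 erefl erefl erefl (addr0 1) erefl
  (addr0 1) y y v.
rewrite mulr1 expr1 scaleN1r -/(br1m y v) -/(br11 y y) -/(br2m (br11 y y) v).
have sk (a : M 0) (x : M 1) : dbr (addr0 1) x a = - ad a x.
  by rewrite (dbr_skew _ (add0r 1)) mulr0 expr0 scale1r.
rewrite sk => E.
have -> : ad (br1m y v) y = - 2%:R^-1 *: br2m (br11 y y) v.
  apply: (scalerI h); rewrite scalerA mulrN divff //.
  rewrite -[br2m _ _](addrK (- - ad (br1m y v) y)) -E.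
  by lmod (K : Type).
have -> : d0 (br1m y v) = br2m (d1 y) v + ad (dm v) y.
  rewrite /d0 /br1m (ddiff_dbr _ (erefl : 1 + 1 = 2%Z) (addNr 1) _
  (erefl : 2%Z + -1 = 1%R :> int) (addr0 1)) sk expr1.
  by rewrite scaleN1r opprK.
have : br2m (curv y) v = 0 by rewrite cy br2m0l.
rewrite /curv !lowE => /eqP; rewrite addr_eq0 => /eqP ->.
by lmod (K : Type).
Qed.

Section Derivation.
Variable D : derivation M.
Section Degree.
Variable i : int.
Lemma der0 : D i 0 = 0.
Proof. by case: (linear_morph (@der_linear K M D i)). Qed.
Lemma derD x y : D i (x + y) = D i x + D i y.
Proof. by case: (linear_morph (@der_linear K M D i)). Qed.
Lemma derN x : D i (- x) = - D i x.
Proof. by case: (linear_morph (@der_linear K M D i)). Qed.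
Lemma derZ c x : D i (c *: x) = c *: D i x.
Proof. by case: (linear_morph (@der_linear K M D i)). Qed.
Lemma der_ad a (x : M i) : D i (ad a x) = ad (D 0 a) x + ad a (D i x).
Proof. exact: der_dbr. Qed.
End Degree.
Lemma der_d0 a : D 1 (d0 a) = d0 (D 0 a). Proof. exact: der_ddiff. Qed.
Lemma der_d1 x : D 2 (d1 x) = d1 (D 1 x). Proof. exact: der_ddiff. Qed.
Lemma der_br11 x y : D 2 (br11 x y) = br11 (D 1 x) y + br11 x (D 1 y).
Proof. exact: der_dbr. Qed.
Definition derE := (der0, derD, derN, derZ, der_ad, der_d0, der_d1, der_br11).

(** An infinitesimal form of the statement that the gauge action preserves
    Maurer-Cartan elements. *)
Lemma flow_curv (c : M 0) (y : M 1) :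
  D 1 y = ad c y - d0 c -> D 2 (curv y) = ad c (curv y).
Proof.
move=> Dy; have h := two_neq0.
rewrite /curv !derE Dy !lowE d1_d0 d1_ad ad_br11.
rewrite ![br11 _ y]br11C.
by lmod_with (K : Type) ltac:(field).
Qed.

End Derivation.

(** If y flows along g for D, and c flows along g with source D' g, then the
    defect of y from flowing along c for D' flows along g. *)
Lemma flow_defect (D D' : derivation M) (g c : M 0) (y : M 1) :
  D 1 (D' 1 y) = D' 1 (D 1 y) ->
  D 1 y = ad g y - d0 g -> D 0 c = D' 0 g + ad g c ->
  let H := D' 1 y - ad c y + d0 c in D 1 H = ad g H.
Proof.
move=> DD' Dy Dc /=.
rewrite !derE DD' Dy Dc !derE !lowE !d0_ad (ad_ad g c y).
by lmod (K : Type).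
Qed.

End LowDegree.
Arguments ad {K M} a {i} x.

(** ** Nilpotent filtrations *)

(** A finite decreasing filtration of a dgla by subcomplexes, starting with the
    whole algebra, such that bracketing with any element raises the filtration
    degree. *)
Record nilfilt (K : fieldType) (M : dgla K) := NilFilt {
  fil : nat -> forall i, M i -> Prop;
  fil_len : nat;
  fil_top : forall i (x : M i), fil 0 x;
  fil0 : forall k i, fil k (0 : M i);
  filP : forall k i c (x y : M i), fil k x -> fil k y -> fil k (c *: x + y);
  fil_dec : forall k i (x : M i), fil k.+1 x -> fil k x;
  fil_ddiff : forall k i j (e : i + 1 = j) (x : M i),
    fil k x -> fil k (ddiff e x);
  fil_dbr : forall k i j l (e : i + j = l) (x : M i) (y : M j),
    fil k x -> fil k.+1 (dbr e x y);
  fil_end : forall i (x : M i), fil fil_len x -> x = 0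
}.
Arguments fil {K M} n k {i} x : rename.

Section NilFiltration.
Variables (K : fieldType) (M : dgla K) (F : nilfilt M).
Hypothesis char0 : [pchar K] =i pred0.

Section Degree.
Variables (k : nat) (i : int).
Implicit Types x y : M i.

Lemma filZ c x : fil F k x -> fil F k (c *: x).
Proof. by move=> Fx; rewrite -[_ *: _]addr0; apply: filP => //; apply: fil0. Qed.
Lemma filD x y : fil F k x -> fil F k y -> fil F k (x + y).
Proof. by move=> Fx Fy; rewrite -[x]scale1r; apply: filP. Qed.
Lemma filN x : fil F k x -> fil F k (- x).
Proof. by rewrite -scaleN1r; apply: filZ. Qed.
Lemma filB x y : fil F k x -> fil F k y -> fil F k (x - y).
Proof. by move=> Fx Fy; apply: filD => //; apply: filN. Qed.
Lemma fil_sum (I : Type) (r : seq I) (P : pred I) (E : I -> M i) :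
  (forall j, P j -> fil F k (E j)) -> fil F k (\sum_(j <- r | P j) E j).
Proof. by move=> FE; elim/big_rec: _ => [|j x Pj]; [exact: fil0|apply/filD/FE]. Qed.

End Degree.

Lemma fil_dbr_r k i j l (e : j + i = l) (y : M j) (x : M i) :
  fil F k x -> fil F k.+1 (dbr e y x).
Proof.
move=> Fx; have e' : i + j = l by rewrite addrC.
by rewrite (dbr_skew e e'); apply/filN/filZ/fil_dbr.
Qed.

Lemma fil_adr k i a (x : M i) : fil F k x -> fil F k.+1 (ad a x).
Proof. exact: fil_dbr_r. Qed.

Lemma fil_le k l i (x : M i) : (l <= k)%N -> fil F k x -> fil F l x.
Proof.
move=> /subnKC <-; elim: (k - l)%N => [|n IH]; rewrite ?addn0 // addnS.
by move=> /fil_dec.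
Qed.

Lemma fil_adl k i a (x : M i) : fil F k a -> fil F k.+1 (ad a x).
Proof. exact: fil_dbr. Qed.
Lemma fil_br11r k x y : fil F k y -> fil F k.+1 (br11 x y :> M 2).
Proof. exact: fil_dbr_r. Qed.
Lemma fil_br12r k x y : fil F k y -> fil F k.+1 (br12 x y :> M 3).
Proof. exact: fil_dbr_r. Qed.
Lemma fil_br1mr k x y : fil F k y -> fil F k.+1 (br1m x y :> M 0).
Proof. exact: fil_dbr_r. Qed.
Lemma fil_dm k x : fil F k x -> fil F k (dm x :> M 0).
Proof. exact: fil_ddiff. Qed.
Lemma fil_d0 k x : fil F k x -> fil F k (d0 x :> M 1).
Proof. exact: fil_ddiff. Qed.

Lemma fil_iter_ad k n i a (x : M i) :
  fil F k x -> fil F (k + n) (iter n (ad a) x).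
Proof. by move=> Fx; elim: n => [|n IH]; rewrite ?addn0 // addnS; apply: fil_adr. Qed.

Lemma iter_ad_eq0 n i a (x : M i) : (fil_len F <= n)%N -> iter n (ad a) x = 0.
Proof.
by move=> len; apply/(fil_end (n := F))/(fil_le len)/(fil_iter_ad (k := 0))/fil_top.
Qed.

(** The value at time 1 of the solution of the linear differential equation
    u' = [a, u] + (v - [a, u0]) with initial value u0. *)
Definition exps (a : M 0) (i : int) (u0 v : M i) : M i :=
  u0 + \sum_(n < fil_len F) (n.+1`!%:R)^-1 *: iter n (ad a) v.

(** The gauge action exp(a)(x). *)
Definition gact (a : M 0) (x : M 1) : M 1 := exps a x (ad a x - d0 a).

Lemma exps_mod k (a : M 0) i (u0 v : M i) :
  fil F k v -> fil F k.+1 (exps a u0 v - (u0 + v)).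
Proof.
move=> Fv; rewrite /exps opprD addrACA subrr add0r.
case E: (fil_len F) => [|n].
  by rewrite [X in fil F _ X](fil_end (n := F)); [exact: fil0|rewrite E; exact: fil_top].
rewrite big_ord_recl /= invr1 scale1r addrAC subrr add0r.
apply: fil_sum => j _; apply: filZ; rewrite /=.
by apply: (fil_le _ (fil_iter_ad j.+1 _ Fv)); rewrite addnS ltnS leq_addr.
Qed.

(** The nonlinear part of [exps] in (a, v) contracts the filtration. *)
Lemma exps_contr k (a b : M 0) i (v w : M i) :
  fil F k (a - b) -> fil F k (v - w) ->
  fil F k.+1 ((exps a 0 v - v) - (exps b 0 w - w)).
Proof.
move=> ab vw; rewrite /exps !add0r; case E: (fil_len F) => [|l].
  rewrite [X in fil _ _ X](fil_end (n := F)); first exact: fil0.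
  by rewrite E; apply: fil_top.
rewrite !big_ord_recl /= invr1 !scale1r.
rewrite ![v + _]addrC ![w + _]addrC !addrK -sumrB; apply: fil_sum => j _.
rewrite -scalerBr; apply: filZ; rewrite -!iterS.
elim: (nat_of_ord j) => [|m IH].
  have -> : ad a v - ad b w = ad (a - b) v + ad b (v - w).
    by rewrite !lowE; lmod (K : Type).
  by apply: filD; [apply: fil_adl|apply: fil_adr].
rewrite 2!iterS; set x := iter _ _ v in IH *; set y := iter _ _ w in IH *.
have -> : ad a x - ad b y = ad (a - b) x + ad b (x - y).
  by rewrite !lowE; lmod (K : Type).
by apply: filD; [apply: fil_adl|apply/fil_dec/fil_adr].
Qed.

Lemma gact_mod k a x : fil F k a -> fil F k.+1 (gact a x - (x - d0 a)).
Proof.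
move=> Fa.
have -> : gact a x - (x - d0 a) =
    (gact a x - (x + (ad a x - d0 a))) + ad a x by lmod (K : Type).
apply: filD; last exact: fil_adl.
by apply: exps_mod; apply: filB; [apply/fil_dec/fil_adl|apply: fil_d0].
Qed.

End NilFiltration.

(** * Formal power series with coefficients in a dgla *)

Section TriangularSums.
Variable V : nmodType.
Implicit Type G : nat -> nat -> nat -> V.

(** Both lemmas reindex the sum of G p q r over p + q + r = n. *)
Lemma triangular_suml G n :
  \sum_(m < n.+1) \sum_(p < m.+1) G p (m - p)%N (n - m)%N =
  \sum_(p < n.+1) \sum_(q < (n - p).+1) G p q (n - p - q)%N.
Proof.
transitivity (\sum_(0 <= m < n.+1) \sum_(0 <= p < n.+1 | (p <= m)%N)
  G p (m - p)%N (n - m)%N).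
  rewrite big_mkord; apply: eq_bigr => m _.
  rewrite -(big_mkord xpredT (fun p => G p (m - p)%N (n - m)%N)).
  by rewrite (big_nat_widen 0 m.+1 n.+1).
rewrite (exchange_big_dep_nat xpredT) //= big_mkord; apply: eq_bigr => p _.
rewrite -(big_mkord xpredT (fun q => G p q (n - p - q)%N)).
transitivity (\sum_(p <= m < n.+1) G p (m - p)%N (n - m)%N).
  rewrite (big_cat_nat (n := p)) //=; last by rewrite ltnW.
  rewrite big_nat_cond big_pred0 ?add0r.
    rewrite big_nat_cond [RHS]big_nat_cond; apply: eq_bigl => m /=.
    by case: (leqP p m); rewrite ?andbT ?andbF.
  by move=> m /=; case: (ltnP m p); rewrite ?andbF.
rewrite -{1}[val p]add0n big_addn subSn ?(leq_ord p) //.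
by apply: eq_bigr => q _; rewrite addnK subnDA subnAC.
Qed.

Lemma triangular_sumC G n :
  \sum_(p < n.+1) \sum_(q < (n - p).+1) G p q (n - p - q)%N =
  \sum_(q < n.+1) \sum_(p < (n - q).+1) G p q (n - q - p)%N.
Proof.
have E (H : nat -> nat -> nat -> V) :
    \sum_(p < n.+1) \sum_(q < (n - p).+1) H p q (n - p - q)%N =
    \sum_(0 <= p < n.+1) \sum_(0 <= q < n.+1 | (p + q <= n)%N)
      H p q (n - (p + q))%N.
  rewrite big_mkord; apply: eq_bigr => p _.
  rewrite -(big_mkord xpredT (fun q => H p q (n - p - q)%N)).
  rewrite (big_nat_widen 0 _ n.+1) ?ltnS ?leq_subr //=.
  apply: eq_big => [q|q _]; last by rewrite subnDA.
  by rewrite ltnS leq_subRL // (leq_ord p).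
rewrite E (E (fun q p => G p q)) (exchange_big_dep_nat xpredT) //=.
by apply: eq_bigr => q _; apply: eq_big => [p|p _]; rewrite addnC.
Qed.

End TriangularSums.

Section PowerSeries.
Variables (K : fieldType) (M : dgla K).

Definition ps_sort (i : int) : lmodType K := (nat -> M i : lmodType K).

Definition ps_dbr (i j k : int) (e : i + j = k) (u : ps_sort i)
    (v : ps_sort j) : ps_sort k :=
  fun n => \sum_(p < n.+1) dbr e (u p) (v (n - p)%N).
Definition ps_ddiff (i j : int) (e : i + 1 = j) (u : ps_sort i) : ps_sort j :=
  fun n => ddiff e (u n).

Fact ps_dbr_linear_l (i j k : int) (e : i + j = k) v :
  linear (fun u => ps_dbr e u v).
Proof.
move=> c u u'; apply/funext => n; rewrite /ps_dbr.
rewrite -[RHS]/(c *: (\sum_(p < n.+1) _) + \sum_(p < n.+1) _).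
rewrite scaler_sumr -big_split; apply: eq_bigr => p _ /=.
by rewrite -dbrZl -dbrDl.
Qed.

Fact ps_dbr_linear_r (i j k : int) (e : i + j = k) u : linear (ps_dbr e u).
Proof.
move=> c v v'; apply/funext => n; rewrite /ps_dbr.
rewrite -[RHS]/(c *: (\sum_(p < n.+1) _) + \sum_(p < n.+1) _).
rewrite scaler_sumr -big_split; apply: eq_bigr => p _ /=.
by rewrite -dbrZr -dbrDr.
Qed.

Fact ps_dbr_skew (i j k : int) (e : i + j = k) (e' : j + i = k) u v :
  ps_dbr e u v = - ((-1) ^+ absz (i * j) *: ps_dbr e' v u).
Proof.
apply/funext => n.
rewrite -[RHS]/(- (_ *: (\sum_(p < n.+1) dbr e' (v p) (u (n - p)%N)))).
rewrite scaler_sumr -sumrN /ps_dbr (reindex_inj rev_ord_inj) /=.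
apply: eq_bigr => p _; rewrite subSS subKn ?(leq_ord p) //.
exact: dbr_skew.
Qed.

Fact ps_dbr_jacobi (i j k ij jk ik l : int)
      (eij : i + j = ij) (ejk : j + k = jk) (eik : i + k = ik)
      (e1 : i + jk = l) (e2 : ij + k = l) (e3 : j + ik = l) x y z :
    ps_dbr e1 x (ps_dbr ejk y z) =
    ps_dbr e2 (ps_dbr eij x y) z
    + (-1) ^+ absz (i * j) *: ps_dbr e3 y (ps_dbr eik x z).
Proof.
apply/funext => n.
rewrite -[RHS]/(\sum_(m < n.+1) dbr e2 (\sum_(p < m.+1)
  dbr eij (x p) (y (m - p)%N)) (z (n - m)%N) + (-1) ^+ absz (i * j) *:
  (\sum_(q < n.+1) dbr e3 (y q) (\sum_(p < (n - q).+1)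
     dbr eik (x p) (z (n - q - p)%N)))).
rewrite /ps_dbr.
under eq_bigr do rewrite (linear_sumr _ _ _ (dbr_linear_r e1 _)).
under [X in X + _]eq_bigr do
  rewrite (linear_sumr _ _ _ (dbr_linear_l e2 _)).
under [X in _ *: X]eq_bigr do rewrite (linear_sumr _ _ _ (dbr_linear_r e3 _)).
rewrite (triangular_suml
  (fun p q r => dbr e2 (dbr eij (x p) (y q)) (z r))).
rewrite -(triangular_sumC
  (fun p q r => dbr e3 (y q) (dbr eik (x p) (z r)))).
rewrite scaler_sumr -big_split; apply: eq_bigr => p _ /=.
rewrite scaler_sumr -big_split; apply: eq_bigr => q _ /=.
exact: dbr_jacobi.
Qed.

Fact ps_ddiff_linear (i j : int) (e : i + 1 = j) : linear (ps_ddiff e).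
Proof.
move=> c u u'; apply/funext => n.
exact: ddiff_linear.
Qed.

Fact ps_ddiff_ddiff (i j k : int) (e : i + 1 = j) (e' : j + 1 = k) u :
  ps_ddiff e' (ps_ddiff e u) = 0.
Proof. by apply/funext => n; apply: ddiff_ddiff. Qed.

Fact ps_ddiff_dbr (i j k i' j' k' : int) (e : i + j = k)
      (ei : i + 1 = i') (ej : j + 1 = j') (ek : k + 1 = k')
      (e1 : i' + j = k') (e2 : i + j' = k') x y :
    ps_ddiff ek (ps_dbr e x y) =
    ps_dbr e1 (ps_ddiff ei x) y
    + (-1) ^+ absz i *: ps_dbr e2 x (ps_ddiff ej y).
Proof.
apply/funext => n.
rewrite -[RHS]/((\sum_(p < n.+1) dbr e1 (ddiff ei (x p)) (y (n - p)%N)) +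
  (-1) ^+ absz i *:
    \sum_(p < n.+1) dbr e2 (x p) (ddiff ej (y (n - p)%N))).
rewrite /ps_ddiff /ps_dbr (linear_sumr _ _ _ (ddiff_linear ek)).
rewrite scaler_sumr -big_split; apply: eq_bigr => p _ /=.
exact: ddiff_dbr.
Qed.

(** The dgla M[[t]], with the bracket extended by t-bilinearity. *)
Definition ps : dgla K :=
  DGLA ps_dbr_linear_l ps_dbr_linear_r ps_dbr_skew ps_dbr_jacobi
    ps_ddiff_linear ps_ddiff_ddiff ps_ddiff_dbr.

(** Coefficients of a series, and the series with given coefficients. *)
Definition cf (i : int) (u : ps i) (n : nat) : M i := u n.
Definition mkps (i : int) (u : nat -> M i) : ps i := u.

Section Coefficients.
Variable i : int.
Implicit Types u v : ps i.
Lemma psP u v : (forall n, cf u n = cf v n) -> u = v.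
Proof. by move=> uv; apply/funext. Qed.
Lemma cf_mk (u : nat -> M i) n : cf (mkps u) n = u n. Proof. by []. Qed.
Lemma cf0 n : cf (0 : ps i) n = 0. Proof. by []. Qed.
Lemma cfD u v n : cf (u + v) n = cf u n + cf v n. Proof. by []. Qed.
Lemma cfN u n : cf (- u) n = - cf u n. Proof. by []. Qed.
Lemma cfZ c u n : cf (c *: u) n = c *: cf u n. Proof. by []. Qed.
Lemma cf_sum (I : Type) (r : seq I) (P : pred I) (E : I -> ps i) n :
  cf (\sum_(j <- r | P j) E j) n = \sum_(j <- r | P j) cf (E j) n.
Proof. exact: (big_morph (fun u : ps i => cf u n) (fun u v => cfD u v n) (cf0 n)). Qed.
Lemma cf_ad a u n : cf (ad a u) n = \sum_(p < n.+1) ad (cf a p) (cf u (n - p)%N).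
Proof. by []. Qed.
End Coefficients.
Lemma cf_br11 u v n :
  cf (br11 u v) n = \sum_(p < n.+1) br11 (cf u p) (cf v (n - p)%N).
Proof. by []. Qed.
Lemma cf_br1m u v n :
  cf (br1m u v) n = \sum_(p < n.+1) br1m (cf u p) (cf v (n - p)%N).
Proof. by []. Qed.
Lemma cf_dm u n : cf (dm u) n = dm (cf u n). Proof. by []. Qed.
Lemma cf_d0 u n : cf (d0 u) n = d0 (cf u n). Proof. by []. Qed.
Lemma cf_d1 u n : cf (d1 u) n = d1 (cf u n). Proof. by []. Qed.

Definition cfE := (cf0, cfD, cfN, cfZ, cf_sum, cf_dm, cf_d0, cf_d1).

(** The monomial x t^k. *)
Definition mono (k : nat) (i : int) (x : M i) : ps i :=
  mkps (fun n => if n == k then x else 0).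

Lemma cf_mono k i (x : M i) n : cf (mono k x) n = if n == k then x else 0.
Proof. by []. Qed.

Lemma monoN k i (x : M i) : mono k (- x) = - mono k x.
Proof. by apply: psP => n; rewrite cfN !cf_mono; case: eqP; rewrite ?oppr0. Qed.

Lemma ad_mono1S i a (u : ps i) n : cf (ad (mono 1 a) u) n.+1 = ad a (cf u n).
Proof.
rewrite cf_ad big_ord_recl big_ord_recl /= big1 => [|p _].
  by rewrite !cf_mono /= ad0l add0r addr0 /bump /= subn1.
by rewrite cf_mono /= ad0l.
Qed.

Lemma ad_mono10 i a (u : ps i) : cf (ad (mono 1 a) u) 0 = 0.
Proof. by rewrite cf_ad big_ord1 cf_mono ad0l. Qed.

Lemma d0_mono k a : d0 (mono k a) = mono k (d0 a).
Proof. by apply: psP => n; rewrite cf_d0 !cf_mono; case: eqP; rewrite ?d00. Qed.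

(** The Euler derivation t d/dt. Unlike d/dt it preserves the degree in t; it
    has primitives for the series without constant term. *)
Definition euler_fun (i : int) (u : ps i) : ps i :=
  mkps (fun n => n%:R *: cf u n).

Fact euler_linear i : linear (@euler_fun i).
Proof.
move=> c u v; apply: psP => n.
rewrite -[RHS]/(c *: (n%:R *: cf u n) + n%:R *: cf v n) cf_mk !cfE.
by rewrite scalerDr !scalerA mulrC.
Qed.
Fact euler_dbr (i j k : int) (e : i + j = k) x y :
  euler_fun (dbr e x y) = dbr e (euler_fun x) y + dbr e x (euler_fun y).
Proof.
apply: psP => n.
rewrite -[LHS]/(n%:R *: (\sum_(p < n.+1) dbr e (cf x p) (cf y (n - p)%N))).
rewrite -[RHS]/((\sum_(p < n.+1) dbr e (p%:R *: cf x p) (cf y (n - p)%N)) +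
  \sum_(p < n.+1) dbr e (cf x p) ((n - p)%N%:R *: cf y (n - p)%N)).
rewrite scaler_sumr -big_split; apply: eq_bigr => p _ /=.
by rewrite dbrZl dbrZr -scalerDl -natrD subnKC // -ltnS.
Qed.
Fact euler_ddiff (i j : int) (e : i + 1 = j) x :
  euler_fun (ddiff e x) = ddiff e (euler_fun x).
Proof. by apply: psP => n; rewrite -[RHS]/(ddiff e (_ *: _)) ddiffZ. Qed.
Definition euler : derivation ps :=
  Derivation euler_linear euler_dbr euler_ddiff.

Lemma cf_euler i (u : ps i) n : cf (euler i u) n = n%:R *: cf u n.
Proof. by []. Qed.

Lemma euler_mono1 i (x : M i) : euler i (mono 1 x) = mono 1 x.
Proof.
apply: psP => n; rewrite cf_euler cf_mono.
by case: eqP => [->|_]; rewrite (scale1r, scaler0).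
Qed.

(** The extension of a derivation of M to M[[t]] by t-linearity. *)
Section Coefficientwise.
Variable D : derivation M.
Definition ps_der_fun (i : int) (u : ps i) : ps i := mkps (fun n => D i (cf u n)).
Fact ps_der_linear i : linear (@ps_der_fun i).
Proof. by move=> c u v; apply: psP => n; apply: (@der_linear _ _ D). Qed.
Fact ps_der_dbr (i j k : int) (e : i + j = k) x y :
  ps_der_fun (dbr e x y) = dbr e (ps_der_fun x) y + dbr e x (ps_der_fun y).
Proof.
apply: psP => n.
rewrite -[LHS]/(D k (\sum_(p < n.+1) dbr e (cf x p) (cf y (n - p)%N))).
rewrite -[RHS]/((\sum_(p < n.+1) dbr e (D i (cf x p)) (cf y (n - p)%N)) +
  \sum_(p < n.+1) dbr e (cf x p) (D j (cf y (n - p)%N))).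
rewrite (linear_sumr _ _ _ (@der_linear _ _ D k)) -big_split.
by apply: eq_bigr => p _ /=; apply: der_dbr.
Qed.
Fact ps_der_ddiff (i j : int) (e : i + 1 = j) x :
  ps_der_fun (ddiff e x) = ddiff e (ps_der_fun x).
Proof. by apply: psP => n; apply: der_ddiff. Qed.
Definition ps_der : derivation ps :=
  Derivation ps_der_linear ps_der_dbr ps_der_ddiff.
Lemma cf_ps_der i u n : cf (ps_der i u) n = D i (cf u n). Proof. by []. Qed.

Lemma ps_der_mono k i (x : M i) : ps_der i (mono k x) = mono k (D i x).
Proof.
by apply: psP => n; rewrite cf_ps_der !cf_mono; case: eqP; rewrite // der0.
Qed.

Lemma euler_ps_der i (u : ps i) : euler i (ps_der i u) = ps_der i (euler i u).
Proof. by apply: psP => n; rewrite cf_euler !cf_ps_der cf_euler derZ. Qed.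
End Coefficientwise.

(** The coefficientwise filtration of M[[t]]. *)
Section Filtration.
Variable F : nilfilt M.
Definition ps_fil (k : nat) (i : int) (u : ps i) := forall n, fil F k (cf u n).
Fact ps_fil_top i (u : ps i) : ps_fil 0 u.
Proof. by move=> n; apply: fil_top. Qed.
Fact ps_fil0 k i : ps_fil k (0 : ps i).
Proof. by move=> n; apply: fil0. Qed.
Fact ps_filP k i c (u v : ps i) : ps_fil k u -> ps_fil k v -> ps_fil k (c *: u + v).
Proof. by move=> Fu Fv n; apply: filP. Qed.
Fact ps_fil_dec k i (u : ps i) : ps_fil k.+1 u -> ps_fil k u.
Proof. by move=> Fu n; apply: fil_dec. Qed.
Fact ps_fil_ddiff k i j (e : i + 1 = j) (u : ps i) :
  ps_fil k u -> ps_fil k (ddiff e u).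
Proof. by move=> Fu n; apply: fil_ddiff. Qed.
Fact ps_fil_dbr k i j l (e : i + j = l) (u : ps i) (v : ps j) :
  ps_fil k u -> ps_fil k.+1 (dbr e u v).
Proof. by move=> Fu n; apply: fil_sum => p _; apply: fil_dbr. Qed.
Fact ps_fil_end i (u : ps i) : ps_fil (fil_len F) u -> u = 0.
Proof. by move=> Fu; apply: psP => n; apply: (fil_end (n := F)). Qed.
Definition psF : nilfilt ps :=
  NilFilt ps_fil_top ps_fil0 ps_filP ps_fil_dec ps_fil_ddiff ps_fil_dbr
    ps_fil_end.
Lemma fil_mono k l i (x : M i) : fil F k x -> fil psF k (mono l x).
Proof. by move=> Fx n; rewrite cf_mono; case: eqP => // _; apply: fil0. Qed.
End Filtration.

End PowerSeries.
Arguments cf {K M i} u n.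
Arguments euler {K M}.

(** ** Evaluation of polynomials at t = 1 *)

Section Evaluation.
Variables (K : fieldType) (M : dgla K).

(** The series u is a polynomial whose value at t = 1 is x. *)
Definition ev (i : int) (u : ps M i) (x : M i) :=
  exists B, (forall n, (B <= n)%N -> cf u n = 0) /\ x = \sum_(n < B) cf u n.

Lemma ev_widen i (u : ps M i) B C : (forall n, (B <= n)%N -> cf u n = 0) ->
  (B <= C)%N -> \sum_(n < C) cf u n = \sum_(n < B) cf u n.
Proof.
move=> u0 BC; rewrite -!(big_mkord xpredT (cf u)) (big_cat_nat (n := B)) //=.
by rewrite [X in _ + X]big_nat [X in _ + X]big1 ?addr0 // => n /andP[/u0].
Qed.

Lemma ev_fun i (u : ps M i) x y : ev u x -> ev u y -> x = y.
Proof.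
move=> [B [uB ->]] [C [uC ->]].
by rewrite -(ev_widen uB (leq_maxl B C)) (ev_widen uC (leq_maxr B C)).
Qed.

Lemma ev_mono k i (x : M i) : ev (mono k x) x.
Proof.
exists k.+1; split=> [n kn|]; rewrite ?big_ord_recr /= ?cf_mono.
  by rewrite gtn_eqF.
rewrite eqxx big1 ?add0r // => j _; rewrite cf_mono ltn_eqF //.
Qed.

Lemma ev0 i : ev (0 : ps M i) 0.
Proof. by exists 0%N; rewrite big_ord0. Qed.

Lemma evD i (u v : ps M i) x y : ev u x -> ev v y -> ev (u + v) (x + y).
Proof.
move=> [B [uB ->]] [C [uC ->]]; exists (maxn B C); split=> [n|].
  by rewrite geq_max cfD => /andP[Bn Cn]; rewrite uB // uC // addr0.
rewrite -(ev_widen uB (leq_maxl B C)) -(ev_widen uC (leq_maxr B C)).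
by rewrite -big_split.
Qed.

Lemma evZ i c (u : ps M i) x : ev u x -> ev (c *: u) (c *: x).
Proof.
move=> [B [uB ->]]; exists B; split=> [n Bn|]; first by rewrite cfZ uB // scaler0.
by rewrite scaler_sumr.
Qed.

Lemma evN i (u : ps M i) x : ev u x -> ev (- u) (- x).
Proof. by rewrite -scaleN1r -(scaleN1r x); apply: evZ. Qed.

Lemma evB i (u v : ps M i) x y : ev u x -> ev v y -> ev (u - v) (x - y).
Proof. by move=> ux /evN; apply: evD. Qed.

Lemma ev_sum i (I : Type) (r : seq I) (E : I -> ps M i) (e : I -> M i) :
  (forall j, ev (E j) (e j)) -> ev (\sum_(j <- r) E j) (\sum_(j <- r) e j).
Proof.
by move=> Ee; elim/big_ind2: _ => [|u x v y|j _]; [exact: ev0|exact: evD|].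
Qed.

Lemma ev_dbr i j k (e : i + j = k) (u : ps M i) (v : ps M j) x y :
  ev u x -> ev v y -> ev (dbr e u v) (dbr e x y).
Proof.
move=> [B [uB ->]] [C [vC ->]].
have dE n : cf (dbr e u v) n = \sum_(p < n.+1) dbr e (cf u p) (cf v (n - p)%N).
  by [].
exists (B + C).+1; split=> [n BCn|].
  rewrite dE big1 // => p _; have [Bp|pB] := leqP B p; first by rewrite uB ?dbr0l.
  rewrite vC ?dbr0r // leq_subRL ?(leq_ord p) //.
  by apply: leq_trans (ltnW BCn); rewrite leq_add2r ltnW.
under [RHS]eq_bigr do rewrite dE.
rewrite (triangular_suml (fun p q _ => dbr e (cf u p) (cf v q))).
transitivity (\sum_(p < (B + C).+1) dbr e (cf u p) (\sum_(n < C) cf v n)).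
  rewrite -(ev_widen uB (_ : (B <= (B + C).+1)%N)) ?leqW ?leq_addr //.
  exact: (linear_sumr _ _ _ (dbr_linear_l e _)).
apply: eq_bigr => p _; have [Bp|pB] := leqP B p.
  by rewrite uB // dbr0l big1 // => q _; rewrite dbr0l.
rewrite -(linear_sumr _ _ _ (dbr_linear_r e _)); congr dbr.
apply/esym/ev_widen => //; apply: leqW; rewrite leq_subRL ?(leq_ord p) //.
by rewrite leq_add2r ltnW.
Qed.

Lemma ev_ddiff i j (e : i + 1 = j) (u : ps M i) x :
  ev u x -> ev (ddiff e u) (ddiff e x).
Proof.
move=> [B [uB ->]]; exists B; split=> [n Bn|].
  by rewrite -[LHS]/(ddiff e (cf u n)) uB ?ddiff0.
exact: (linear_sumr _ _ _ (ddiff_linear e)).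
Qed.

Lemma ev_der (D : derivation M) i (u : ps M i) x :
  ev u x -> ev (ps_der D i u) (D i x).
Proof.
move=> [B [uB ->]]; exists B; split=> [n Bn|].
  by rewrite cf_ps_der uB ?der0.
exact: (linear_sumr _ _ _ (der_linear D (i := i))).
Qed.

Lemma ev_ad i a b (u : ps M i) x : ev a b -> ev u x -> ev (ad a u) (ad b x).
Proof. exact: ev_dbr. Qed.
Lemma ev_d0 a b : ev a b -> ev (d0 a) (d0 b).
Proof. exact: ev_ddiff. Qed.
Lemma ev_curv y z : ev y z -> ev (curv y) (curv z).
Proof.
by move=> yz; apply: evD; [exact: ev_ddiff|apply: evZ; exact: ev_dbr].
Qed.

Lemma ev_exps (F : nilfilt M) i a b (u v : ps M i) x y :
  ev a b -> ev u x -> ev v y -> ev (exps (psF F) a u v) (exps F b x y).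
Proof.
move=> ab ux vy; apply: evD => //; apply: ev_sum => n; apply: evZ.
by elim: (val n) => //= m IH; apply: ev_ad.
Qed.

Lemma ev_gact (F : nilfilt M) a b x y :
  ev a b -> ev x y -> ev (gact (psF F) a x) (gact F b y).
Proof.
by move=> ab xy; apply: ev_exps => //; apply: evB; [apply: ev_ad|apply: ev_d0].
Qed.

Lemma cf0_ad i a (u : ps M i) : cf (ad a u) 0 = ad (cf a 0) (cf u 0).
Proof. by rewrite cf_ad big_ord1. Qed.

Lemma cf0_exps (F : nilfilt M) i a (u v : ps M i) :
  cf (exps (psF F) a u v) 0 = exps F (cf a 0) (cf u 0) (cf v 0).
Proof.
rewrite /exps cfD cf_sum; congr (_ + _); apply: eq_bigr => n _; rewrite cfZ.
by congr (_ *: _); elim: (val n) => //= m IH; rewrite cf0_ad IH.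
Qed.

Lemma cf0_gact (F : nilfilt M) a x :
  cf (gact (psF F) a x) 0 = gact F (cf a 0) (cf x 0).
Proof. by rewrite /gact cf0_exps !cfE cf0_ad. Qed.

Hypothesis char0 : [pchar K] =i pred0.

(** The primitive for the Euler derivation; the constant coefficient is 0
    because 0^-1 = 0. *)
Definition eint (i : int) (u : ps M i) : ps M i :=
  mkps (fun n => (n%:R)^-1 *: cf u n).

Lemma cf_eint i (u : ps M i) n : cf (eint u) n = n%:R^-1 *: cf u n.
Proof. by []. Qed.

Lemma eulerK i (u : ps M i) : cf u 0 = 0 -> euler i (eint u) = u.
Proof.
move=> u0; apply: psP => -[|n]; rewrite cf_euler cf_mk ?u0 ?scaler0 //.
by rewrite scalerA divff ?scale1r // natK_neq0.
Qed.

Lemma cf0_eint i (u : ps M i) : cf (eint u) 0 = 0.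
Proof. by rewrite cf_mk invr0 scale0r. Qed.

Lemma ev_eint i (u : ps M i) x : ev u x -> exists y, ev (eint u) y.
Proof.
move=> [B [uB _]]; exists (\sum_(n < B) cf (eint u) n), B; split=> // n Bn.
by rewrite cf_mk uB ?scaler0.
Qed.

Lemma ev_euler i (u : ps M i) x : ev u x -> exists y, ev (euler i u) y.
Proof.
move=> [B [uB _]]; exists (\sum_(n < B) cf (euler i u) n), B; split=> // n Bn.
by rewrite cf_euler uB ?scaler0.
Qed.

Lemma euler_mono0 i (x : M i) : euler i (mono 0 x) = 0.
Proof.
by apply: psP => -[|n]; rewrite cf_euler cf_mono ?scale0r ?scaler0.
Qed.

Lemma euler_eq0 i (u : ps M i) : euler i u = 0 -> u = mono 0 (cf u 0).
Proof.
move=> Eu; apply: psP => -[|n]; rewrite cf_mono //=.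
have /eqP := congr1 (fun w => cf w n.+1) Eu; rewrite cf_euler cf0 scaler_eq0.
by rewrite (negPf (natK_neq0 char0 n)) => /eqP.
Qed.

(** ** Linear differential equations *)

(** A linear flow with zero initial value vanishes: its n-th coefficient is
    determined by the previous ones, as c has no constant term. *)
Lemma flow_eq0 i (c : ps M 0) (H : ps M i) :
  cf c 0 = 0 -> cf H 0 = 0 -> euler i H = ad c H -> H = 0.
Proof.
move=> c0 H0 EH; apply: psP => n; rewrite cf0.
elim/ltn_ind: n => -[|n] IH //.
have := congr1 (fun w => cf w n.+1) EH.
rewrite cf_euler cf_ad big_ord_recl c0 ad0l add0r big1 => [/eqP|p _].
  by rewrite scaler_eq0 (negPf (natK_neq0 char0 n)) => /eqP.
by rewrite IH ?ad0r // lift0 subSS ltnS leq_subr.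
Qed.

(** A path of gauge transformations: y flows along c, that is,
    t y' = [c, y] - d c, where c has no constant term. *)
Definition path (c : ps M 0) (y : ps M 1) :=
  cf c 0 = 0 /\ euler 1 y = ad c y - d0 c.

Lemma path_unique c y z : path c y -> path c z -> cf y 0 = cf z 0 -> y = z.
Proof.
move=> [c0 Ey] [_ Ez] yz; apply/eqP; rewrite -subr_eq0; apply/eqP.
apply: (flow_eq0 c0); first by rewrite cfD cfN yz subrr.
by rewrite derD derN Ey Ez !lowE; lmod (K : Type).
Qed.

(** The solution of the linear equation of [exps], as a power series in the
    time; it is a polynomial with value [exps] at time 1. *)
Definition sol (a : M 0) (i : int) (u0 v : M i) : ps M i :=
  mkps (fun n => if n is m.+1 then (m.+1`!%:R)^-1 *: iter m (ad a) v else u0).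

Lemma ev_sol (F : nilfilt M) a i (u0 v : M i) : ev (sol a u0 v) (exps F a u0 v).
Proof.
exists (fil_len F).+1; split=> [[|n]|]; rewrite ?ltnS //.
  by move=> Fn; rewrite cf_mk (iter_ad_eq0 _ _ Fn) scaler0.
by rewrite big_ord_recl.
Qed.

Lemma sol_euler a i (u0 v : M i) :
  let u := sol a u0 (ad a u0 + v) in
  euler i u = ad (mono 1 a) u + mono 1 v.
Proof.
apply: psP => -[|[|n]]; rewrite cf_euler cfD (ad_mono10, ad_mono1S) ?scale0r cf_mono /=.
- by rewrite addr0.
- by rewrite !cf_mk /= invr1 !scale1r.
- rewrite addr0 !cf_mk /= adZr scalerA factS natrM invfM mulrA divff ?mul1r //.
  exact: natK_neq0.
Qed.

End Evaluation.

(** ** Gauge transformations *)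

Section Gauge.
Variables (K : fieldType) (char0 : [pchar K] =i pred0).

(** The gauge action preserves Maurer-Cartan elements: along the path exp(sa) x
    the curvature satisfies a linear flow, with zero initial value. *)
Lemma gact_curv (M : dgla K) (F : nilfilt M) (a : M 0) (x : M 1) :
  curv x = 0 -> curv (gact F a x) = 0.
Proof.
move=> cx; pose w := sol a x (ad a x - d0 a).
have Ew : euler 1 w = ad (mono 1 a) w - d0 (mono 1 a).
  by rewrite sol_euler // d0_mono -monoN.
have cw0 : curv w = 0.
  apply: (flow_eq0 char0 (c := mono 1 a)); rewrite ?cf_mono //.
    by rewrite /curv cfD cf_d1 cfZ cf_br11 big_ord1.
  exact: flow_curv.
have := ev_curv (ev_sol F a x (ad a x - d0 a)).
by rewrite -/w cw0 => /ev_fun; apply; apply: ev0.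
Qed.

(** The gauge transformation of a flow line: if y flows along c for a derivation
    D, then its transform by g flows along the transform of c, for the affine
    action of g with source D g. *)
Lemma gact_flow (M : dgla K) (F : nilfilt M) (D : derivation M) g c y :
  D 1 y = ad c y - d0 c ->
  let c1 := exps F g c (ad g c + D 0 g) in
  D 1 (gact F g y) = ad c1 (gact F g y) - d0 c1.
Proof.
move=> Dy c1; pose w := sol g y (ad g y - d0 g).
pose C := sol g c (ad g c + D 0 g).
have Ew : euler 1 w = ad (mono 1 g) w - d0 (mono 1 g).
  by rewrite sol_euler // d0_mono -monoN.
have EC : euler 0 C = ps_der D 0 (mono 1 g) + ad (mono 1 g) C.
  by rewrite sol_euler // ps_der_mono addrC.
pose H := ps_der D 1 w - ad C w + d0 C.
have H0 : H = 0.
  apply: (flow_eq0 char0 (c := mono 1 g)); rewrite ?cf_mono //.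
    rewrite /H !cfD cfN cf0_ad cf_ps_der cf_d0 !cf_mk Dy.
    by lmod (K : Type).
  by apply: flow_defect => //; apply: euler_ps_der.
have wE : ev w (gact F g y) by apply: ev_sol.
have CE : ev C c1 by apply: ev_sol.
have : ev H (D 1 (gact F g y) - ad c1 (gact F g y) + d0 c1).
  by apply: evD; [apply: evB; [exact: ev_der|exact: ev_ad]|exact: ev_d0].
rewrite H0 => /ev_fun/(_ (ev0 _ _)) E.
by rewrite -[LHS]subr0 -E; lmod (K : Type).
Qed.

Lemma exps_ad0 (M : dgla K) (F : nilfilt M) a i (u v : M i) :
  ad a v = 0 -> exps F a u v = u + v.
Proof.
move=> av; congr (_ + _); case E: (fil_len F) => [|n].
  by rewrite big_ord0; apply/esym/(fil_end (n := F)); rewrite E; apply: fil_top.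
rewrite big_ord_recl /= invr1 scale1r big1 ?addr0 // => j _.
rewrite -iterS iterSr av (_ : iter j _ _ = 0) ?scaler0 //.
by elim: (val j) => //= m ->; apply: ad0r.
Qed.

Lemma gact0 (M : dgla K) (F : nilfilt M) x : gact F 0 x = x.
Proof.
by rewrite /gact ad0l d00 subr0 exps_ad0 ?ad0l // addr0.
Qed.

Section Group.
Variables (M : dgla K) (F : nilfilt M).

(** The path exp(ta) x. *)
Lemma path_gact a x :
  path (mono 1 a) (gact (psF F) (mono 1 a) (mono 0 x)).
Proof.
split; first by rewrite cf_mono.
have := @gact_flow _ (psF F) (euler) (mono 1 a) 0 (mono 0 x).
rewrite ad0l d00 subr0 euler_mono0 ad0r add0r euler_mono1 => /(_ erefl) /=.
by rewrite exps_ad0 ?add0r // adxx // two_neq0.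
Qed.

Lemma gact_path g c y : path c y ->
  path (exps (psF F) g c (ad g c + euler 0 g)) (gact (psF F) g y).
Proof.
move=> [c0 Ey]; split; last exact: gact_flow.
rewrite cf0_exps cfD cf0_ad cf_euler scale0r c0 ad0r addr0.
by rewrite exps_ad0 ?ad0r // addr0.
Qed.

(** Along exp(-ta) exp(ta) x the transformed c vanishes, so that this path is
    constant. *)
Lemma gactK a x : gact F (- a) (gact F a x) = x.
Proof.
have char2 := two_neq0 char0.
have [_ Ez] := gact_path (mono 1 (- a)) (path_gact a x).
pose z := gact (psF F) (mono 1 (- a)) (gact (psF F) (mono 1 a) (mono 0 x)).
rewrite monoN adNl adxx // oppr0 add0r derN euler_mono1 in Ez.
rewrite exps_ad0 ?adNl ?adNr ?adxx ?oppr0 // subrr ad0l d00 subr0 -monoN -/z in Ez.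
have zE := euler_eq0 char0 Ez.
have : ev z (gact F (- a) (gact F a x)).
  by apply: ev_gact (ev_mono _ _) (ev_gact _ (ev_mono _ _) (ev_mono _ _)).
rewrite zE => /ev_fun; apply; rewrite /z !cf0_gact !cf_mono /= !gact0.
exact: ev_mono.
Qed.

(** Every polynomial path of gauge transformations is given by exponentials: the
    equation c = (exp(ad g) - 1)/(ad g) (t g') can be solved for a polynomial g
    without constant term. *)
Lemma magnus (c : ps M 0) z : cf c 0 = 0 -> ev c z ->
  exists g h, [/\ cf g 0 = 0, ev g h & exps (psF F) g 0 (euler 0 g) = c].
Proof.
move=> c0 cz.
(* S is the sum of the terms of degree at least 2 in g, and the solution is the
   fixed point of Phi. *)
pose S g := exps (psF F) g 0 (euler 0 g) - euler 0 g.
pose Phi g := eint (c - S g).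
have S0 g : cf (S g) 0 = 0.
  by rewrite cfD cfN cf0_exps cf_euler scale0r exps_ad0 ?ad0r // cf0 addr0 subr0.
have Scontr k g h : fil (psF F) k (g - h) -> fil (psF F) k.+1 (S g - S h).
  move=> gh.
  have Egh : fil (psF F) k (euler 0 g - euler 0 h).
    by move=> n; rewrite cfD cfN !cf_euler -scalerBr; apply: filZ (gh n).
  exact: exps_contr.
pose g k := iter k Phi 0.
have gcauchy k : fil (psF F) k (g k.+1 - g k).
  elim: k => [|k IH]; first exact: fil_top.
  move=> n; rewrite /g cfD cfN [iter k.+2 _ _]iterS [iter k.+1 _ _ in X in _ - X]iterS.
  rewrite !cf_mk -scalerBr; apply: filZ.
  have -> : cf (c - S (iter k.+1 Phi 0)) n - cf (c - S (iter k Phi 0)) n =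
      - cf (S (g k.+1) - S (g k)) n by rewrite !cfE; lmod (K : Type).
  exact/filN/Scontr.
pose G := g (fil_len F).
have GE : G = Phi G.
  by apply/esym/eqP; rewrite -subr_eq0; apply/eqP/(fil_end (n := psF F))/gcauchy.
have gev k : exists h, ev (g k) h.
  elim: k => [|k [h gh]]; first by exists 0; apply: ev0.
  have [h' Egh] := ev_euler gh.
  have := ev_exps F gh (ev0 _ 0) Egh => Sgh.
  exact: ev_eint (evB cz (evB Sgh Egh)).
have [h Gh] := gev (fil_len F).
exists G, h; split=> //; first by rewrite GE cf0_eint.
have /(congr1 (euler 0)) := GE; rewrite eulerK //; last first.
  by rewrite cfD cfN c0 S0 subr0.
by move=> E; rewrite -[LHS](subrK (euler 0 G)) -/(S G) E addrC subrK.
Qed.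

(** The composite of two gauge transformations of x is a gauge transformation:
    the part of the Baker-Campbell-Hausdorff theorem that is needed. *)
Lemma gactM a b x : exists c, gact F a (gact F b x) = gact F c x.
Proof.
pose y := gact (psF F) (mono 1 b) (mono 0 x).
have [c0 Ez] := gact_path (mono 1 a) (path_gact b x).
set c := exps _ _ _ _ in c0 Ez.
have [e cE] : exists e, ev c e.
  eexists; apply: ev_exps (ev_mono _ _) (ev_mono _ _) _.
  apply: evD; first exact: ev_ad (ev_mono _ _) (ev_mono _ _).
  by rewrite euler_mono1; apply: ev_mono.
have [g [h [g0 gh gc]]] := magnus c0 cE.
exists h; apply: (@ev_fun _ _ _ (gact (psF F) g (mono 0 x))); last first.
  exact: ev_gact gh (ev_mono _ _).
rewrite (_ : gact _ _ _ = gact (psF F) (mono 1 a) y).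
  exact: ev_gact (ev_mono _ _) (ev_gact _ (ev_mono _ _) (ev_mono _ _)).
apply: (path_unique char0 (c := c)) => //.
  have := @gact_path g 0 (mono 0 x); rewrite ad0r add0r gc; apply.
  by split; rewrite ?cf0 // ad0l d00 subr0 euler_mono0.
by rewrite !cf0_gact g0 !cf_mono /= !gact0.
Qed.

Definition gauge_equiv (x y : M 1) := exists a, gact F a x = y.

Lemma gauge_refl x : gauge_equiv x x.
Proof. by exists 0; rewrite gact0. Qed.
Lemma gauge_sym x y : gauge_equiv x y -> gauge_equiv y x.
Proof. by move=> [a <-]; exists (- a); rewrite gactK. Qed.
Lemma gauge_trans x y z : gauge_equiv x y -> gauge_equiv y z -> gauge_equiv x z.
Proof. by move=> [b <-] [a <-]; have [c ->] := gactM a b x; exists c. Qed.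

End Group.
End Gauge.

(** * Comparison of nilpotent dglas *)

Section FilteredSeries.
Variables (K : fieldType) (M : dgla K) (F : nilfilt M).

Lemma ev_fil k i (u : ps M i) x : fil (psF F) k u -> ev u x -> fil F k x.
Proof. by move=> Fu [B [_ ->]]; apply: fil_sum => n _; apply: Fu. Qed.


Lemma fil_eint k i (u : ps M i) : fil (psF F) k u -> fil (psF F) k (eint u).
Proof. by move=> Fu n; apply/filZ/Fu. Qed.

(** A series without constant term is as small as its Euler derivative. *)
Lemma fil_euler_inv (char0 : [pchar K] =i pred0) k i (u : ps M i) :
  cf u 0 = 0 -> fil (psF F) k (euler i u) -> fil (psF F) k u.
Proof.
move=> u0 Fu [|n]; first by rewrite u0; apply: fil0.
rewrite -[cf u _]scale1r -(mulVf (natK_neq0 char0 n)) -scalerA.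
exact/filZ/Fu.
Qed.

Lemma curv_mono0 z : curv (mono 0 z : ps M 1) = mono 0 (curv z).
Proof.
apply: psP => n; rewrite /curv cfD cf_d1 cfZ cf_br11 !cf_mono.
case: n => [|n]; first by rewrite big_ord1 !cf_mono.
rewrite lowE add0r big1 ?scaler0 // => -[[|p] lp] _; rewrite !cf_mono /=.
  by rewrite /br11 dbr0r.
by rewrite /br11 dbr0l.
Qed.

End FilteredSeries.

Section Morphism.
Variables (K : fieldType) (M M' : dgla K) (f : dglaHom M M').
Variables (F : nilfilt M) (F' : nilfilt M').

(* Two filtrations may have different lengths; the common formula allows the
   exponentials of different dglas to be compared. *)
Lemma exps_widen N (P : dgla K) (G : nilfilt P) a i (u v : P i) :
  (fil_len G <= N)%N ->
  exps G a u v = u + \sum_(n < N) (n.+1`!%:R)^-1 *: iter n (ad a) v.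
Proof.
move=> GN; congr (_ + _).
pose h n := (n.+1`!%:R)^-1 *: iter n (ad a) v.
rewrite -(big_mkord xpredT h) -[RHS](big_mkord xpredT h).
rewrite [RHS](big_cat_nat (n := fil_len G)) //=.
rewrite [X in _ + X]big_nat [X in _ + X]big1 ?addr0 // => n /andP[Gn _].
by rewrite /h (iter_ad_eq0 (F := G)) ?scaler0.
Qed.

Lemma dg_map_ad a i (x : M i) : f i (ad a x) = ad (f 0 a) (f i x).
Proof. exact: dg_map_br. Qed.
Lemma dg_map_d0 a : f 1 (d0 a) = d0 (f 0 a). Proof. exact: dg_map_diff. Qed.
Lemma dg_map_d1 x : f 2 (d1 x) = d1 (f 1 x). Proof. exact: dg_map_diff. Qed.
Lemma dg_map_br11 x y : f 2 (br11 x y) = br11 (f 1 x) (f 1 y).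
Proof. exact: dg_map_br. Qed.
Lemma dg_map_curv x : f 2 (curv x) = curv (f 1 x).
Proof. by rewrite /curv dg_mapD dg_mapZ dg_map_d1 dg_map_br11. Qed.

Lemma dg_map_gact a x : f 1 (gact F a x) = gact F' (f 0 a) (f 1 x).
Proof.
rewrite /gact (exps_widen _ _ _ (leq_maxl (fil_len F) (fil_len F'))).
rewrite (exps_widen _ _ _ (leq_maxr (fil_len F) (fil_len F'))) dg_mapD.
congr (_ + _); rewrite (linear_sumr _ _ _ (dg_map_linear f (i := 1))).
apply: eq_bigr => n _; rewrite dg_mapZ; congr (_ *: _).
elim: (nat_of_ord n) => [|m IH] /=; last by rewrite dg_map_ad IH.
by rewrite dg_mapD dg_mapN dg_map_ad dg_map_d0.
Qed.

(** Injectivity and surjectivity in cohomology of degree i for the morphism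
    induced by f on the graded pieces of the filtrations; h and j are the
    degrees before and after i. *)
Definition gr_injective h i j (e0 : h + 1 = i) (e1 : i + 1 = j) :=
  forall k (z : M i) (w : M' h), fil F k z -> fil F k.+1 (ddiff e1 z) ->
    fil F' k w -> fil F' k.+1 (f i z - ddiff e0 w) ->
  exists2 u : M h, fil F k u & fil F k.+1 (z - ddiff e0 u).

Definition gr_surjective h i j (e0 : h + 1 = i) (e1 : i + 1 = j) :=
  forall k (z : M' i), fil F' k z -> fil F' k.+1 (ddiff e1 z) ->
  exists (w : M i) (u : M' h), [/\ fil F k w, fil F' k u,
    fil F k.+1 (ddiff e1 w) & fil F' k.+1 (z - f i w - ddiff e0 u)].

Hypothesis char0 : [pchar K] =i pred0.
Hypothesis f_fil : forall k i (x : M i), fil F k x -> fil F' k (f i x).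
Hypothesis inj2 : gr_injective (erefl : 1 + 1 = 2%Z :> int) (erefl : 2%Z + 1 = 3%Z).
Hypothesis inj1 : gr_injective (add0r 1) (erefl : 1 + 1 = 2%Z :> int).
Hypothesis surj1 : gr_surjective (add0r 1) (erefl : 1 + 1 = 2%Z :> int).
Hypothesis surj0 : gr_surjective (addNr 1) (add0r 1).

(** For a small z, the curvature of x + z is affine in z modulo the next step of
    the filtration. *)
Lemma curv_mod (P : dgla K) (G : nilfilt P) k x z :
  fil G k z -> fil G k.+1 (curv (x + z) - curv x - d1 z).
Proof.
move=> Gz; rewrite curvD //.
have -> : curv x + d1 z + br11 x z + 2%:R^-1 *: br11 z z - curv x - d1 z =
  br11 x z + 2%:R^-1 *: br11 z z by lmod (K : Type).
by apply: filD; [apply: fil_br11r|apply/filZ/fil_br11r].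
Qed.

(** An approximate solution x modulo the k-th step of the filtration is corrected
    to one modulo the next step: first by z, which removes the curvature, then
    by w and u, which remove the discrepancy with y1. *)
Lemma surj_step k y x y1 :
  fil F k (curv x) -> curv y1 = 0 -> gauge_equiv F' y1 y ->
  fil F' k (f 1 x - y1) ->
  exists x' y1', [/\ fil F k.+1 (curv x'), curv y1' = 0, gauge_equiv F' y1' y &
    fil F' k.+1 (f 1 x' - y1')].
Proof.
move=> Fo cy1 y1y Fe; pose e := f 1 x - y1.
have fo (t : M 1) : fil F' k (f 1 t - y1) ->
    fil F' k.+1 (f 2 (curv t) - d1 (f 1 t - y1)).
  move=> Ft; have := curv_mod y1 Ft; rewrite cy1 subr0 [y1 + _]addrC.
  by rewrite subrK -dg_map_curv.
have [z Fz oz] : exists2 u : M 1, fil F k u & fil F k.+1 (curv x - d1 u).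
  apply: (inj2 (w := e)) => //; last exact: fo.
  by rewrite -/(d2 _) d2_curv //; apply/filN/fil_br12r.
pose x2 := x - z.
have cx2 : fil F k.+1 (curv x2).
  have := curv_mod x (filN Fz); rewrite -/x2 d1N => H.
  have -> : curv x2 = (curv x2 - curv x - - d1 z) + (curv x - d1 z).
    by lmod (K : Type).
  exact: filD.
have Fe2 : fil F' k (f 1 x2 - y1).
  rewrite dg_mapD dg_mapN addrAC; apply: filB => //; exact: f_fil.
have de2 : fil F' k.+1 (d1 (f 1 x2 - y1)).
  rewrite -[d1 _](subKr (f 2 (curv x2))); apply: filB; last exact: fo.
  exact: f_fil.
have [w [u [Fw Fu dw eu]]] := surj1 Fe2 de2.
exists (x2 - w), (gact F' (- u) y1); split.
- have := curv_mod x2 (filN Fw); rewrite d1N => H.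
  have -> : curv (x2 - w) = (curv (x2 - w) - curv x2 - - d1 w)
      + (curv x2 - d1 w) by lmod (K : Type).
  by apply: filD => //; apply: filB.
- exact: gact_curv.
- apply: gauge_trans y1y => //; apply: gauge_sym => //.
  by exists (- u).
- have := gact_mod y1 (filN Fu); rewrite d0N dg_mapD dg_mapN => H.
  have -> : f 1 x2 - f 1 w - gact F' (- u) y1 =
      f 1 x2 - y1 - f 1 w - d0 u - (gact F' (- u) y1 - (y1 - - d0 u)).
    by lmod (K : Type).
  exact: filB.
Qed.

(** Every Maurer-Cartan element of the target is equivalent to the image of a
    Maurer-Cartan element of the source. *)
Lemma mc_surj y : curv y = 0 ->
  exists2 x, curv x = 0 & gauge_equiv F' (f 1 x) y.
Proof.
move=> cy.
have H k : exists x y1, [/\ fil F k (curv x), curv y1 = 0, gauge_equiv F' y1 y &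
    fil F' k (f 1 x - y1)].
  elim: k => [|k [x [y1 [cx cy1 y1y xy1]]]]; last exact: surj_step y1y xy1.
  by exists 0, y; split=> //; [exact: fil_top|exact: gauge_refl|exact: fil_top].
have [x [y1 [cx cy1 y1y xy1]]] := H (maxn (fil_len F) (fil_len F')).
exists x; first exact/(fil_end (n := F))/(fil_le (leq_maxl _ _))/cx.
move/(fil_le (leq_maxr _ _))/(fil_end (n := F'))/eqP: xy1.
by rewrite subr_eq0 => /eqP ->.
Qed.

(** The statement proved by descending induction on k: Maurer-Cartan elements
    x and x' that agree modulo the k-th step of the filtration are equivalent as
    soon as their images are joined by a polynomial path flowing along some c in
    the k-th step. *)
Definition mc_inj_at k := forall x x' y c, curv x = 0 -> curv x' = 0 ->
  fil F k (x' - x) -> fil (psF F') k c -> path c y -> curv y = 0 ->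
  cf y 0 = f 1 x -> ev y (f 1 x') -> (exists e, ev c e) -> gauge_equiv F x x'.

Lemma mc_inj_step k : mc_inj_at k.+1 -> mc_inj_at k.
Proof.
move=> IH x x' y c cx cx' Fxx' Fc [c0 Ey] cy y0 y1 [e ce].
have [I cI] := ev_eint ce.
have FI : fil F' k I by apply: ev_fil cI; apply: fil_eint.
have dxx' : fil F k.+1 (d1 (x' - x)).
  have := curv_mod x Fxx'; rewrite [x + _]addrC subrK cx cx' subrr sub0r => /filN.
  by rewrite opprK.
have fxx' : fil F' k.+1 (f 1 (x' - x) - d0 (- I)).
  pose u := y - mono 0 (f 1 x) + d0 (eint c).
  have uE : ev u (f 1 (x' - x) - d0 (- I)).
    rewrite dg_mapD dg_mapN d0N opprK.
    by apply: evD; [apply: evB => //; apply: ev_mono|apply: ev_d0].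
  apply: ev_fil uE; apply: fil_euler_inv => //.
    by rewrite /u !cfD cfN cf_d0 cf0_eint d00 cf_mono y0 subrr addr0.
  rewrite /u !derD derN der_d0 euler_mono0 eulerK // subr0 Ey subrK.
  exact: fil_adl.
(* The integral I of c computes f (x' - x) modulo the next step. *)
have [a' Fa' xa'] := inj1 Fxx' dxx' (filN FI) fxx'.
have dz : fil F' k.+1 (d0 (f 0 (- a') - I)).
  have -> : d0 (f 0 (- a') - I) =
      (f 1 (x' - x - d0 a')) - (f 1 (x' - x) - d0 (- I)).
    by rewrite !(dg_mapD, dg_mapN) !dg_map_d0 !lowE; lmod (K : Type).
  by apply: filB => //; apply: f_fil.
have Fz : fil F' k (f 0 (- a') - I) by apply: filB => //; apply/f_fil/filN.
have [w [u [Fw Fu dw wu]]] := surj0 Fz dz.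
pose a := - a' - w.
have Fa : fil F k a by apply: filB => //; apply: filN.
pose x1 := gact F a x.
have x1x' : fil F k.+1 (x' - x1).
  have -> : x' - x1 = (x' - x - d0 a') - d0 w - (x1 - (x - d0 a)).
    by rewrite /a !lowE; lmod (K : Type).
  by apply: filB; [apply: filB|apply: gact_mod].
have faI : fil F' k.+1 (f 0 a - I - dm u).
  have -> : f 0 a - I - dm u = f 0 (- a') - I - f 0 w - dm u.
    by rewrite /a !(dg_mapD, dg_mapN); lmod (K : Type).
  by [].
(* The path is first modified by an infinitesimal stabilizer of y. *)
pose U := mono 1 u; pose c' := c + (dm U + br1m y U).
have FU : fil (psF F') k U by apply: fil_mono.
have Fc'c : fil (psF F') k.+1 (c' - c - mono 1 (dm u)).
  have -> : c' - c - mono 1 (dm u) = br1m y U + (dm U - mono 1 (dm u)).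
    by rewrite /c'; lmod (K : Type).
  have -> : dm U = mono 1 (dm u).
    apply: psP => n; rewrite cf_dm !cf_mono; case: eqP => // _.
    exact: ddiff0.
  by rewrite subrr addr0; apply: fil_br1mr.
have c'0 : cf c' 0 = 0.
  rewrite /c' !cfD c0 cf_dm cf_br1m big_ord1 cf_mono /=.
  by rewrite /dm /br1m ddiff0 dbr0r !addr0.
have pc' : path c' y.
  split=> //; rewrite Ey /c' adDl d0D (twisted_exact_stab char0 _ cy).
  by lmod (K : Type).
have Fc' : fil (psF F') k c'.
  have -> : c' = (c' - c - mono 1 (dm u)) + (c + mono 1 (dm u)).
    by lmod (K : Type).
  apply: filD; first exact: fil_dec.
  by apply: filD => //; apply/fil_mono/fil_dm.
have [e' c'e] : exists e, ev c' e.
  eexists; apply: evD ce _; apply: evD; first exact: ev_ddiff (ev_mono _ _).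
  exact: ev_dbr y1 (ev_mono _ _).
have [I' cI'] := ev_eint c'e.
have I'I : fil F' k.+1 (I' - I - dm u).
  have := evB (evB cI' cI) (ev_mono 1 (dm u)); apply: ev_fil => n.
  have -> : cf (eint c' - eint c - mono 1 (dm u)) n =
      n%:R^-1 *: cf (c' - c - mono 1 (dm u)) n.
    rewrite !cfE !cf_eint cf_mono !scalerBr; case: eqP => [->|_].
      by rewrite invr1 !scale1r.
    by rewrite scaler0.
  exact/filZ/Fc'c.
(* It is then transformed by a path g from f a to 0. *)
pose r := I' - f 0 a.
have Fr : fil F' k.+1 r.
  have -> : r = I' - I - dm u - (f 0 a - I - dm u) by rewrite /r; lmod (K : Type).
  exact: filB.
pose g := mono 0 (f 0 a) - eint c' + mono 1 r.
have gE : ev g 0.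
  have -> : 0 = f 0 a - I' + r by rewrite /r; lmod (K : Type).
  by apply: evD (ev_mono _ _); apply: evB cI'; apply: ev_mono.
have g0 : cf g 0 = f 0 a by rewrite /g !cfD cfN cf0_eint !cf_mono subr0 addr0.
have Eg : euler 0 g = - c' + mono 1 r.
  by rewrite /g !derD derN euler_mono0 eulerK // euler_mono1 add0r.
have := gact_path char0 F' g pc'; set y2 := gact _ _ _; set c2 := exps _ _ _ _.
move=> p2; have [e2 Ege] := ev_euler gE.
have x1x'E : gauge_equiv F x1 x'.
  apply: (IH x1 x' y2 c2) => //.
  - exact: gact_curv.
  - have -> : c2 = (c2 - (c' + (ad g c' + euler 0 g))) + (ad g c' + mono 1 r).
      by rewrite Eg; lmod (K : Type).
    apply: filD; last by apply: filD; [apply: fil_adr|apply: fil_mono].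
    apply: exps_mod; apply: filD; first exact/fil_dec/fil_adr.
    by rewrite Eg; apply: filD; [apply: filN|apply/fil_dec/fil_mono].
  - exact: gact_curv.
  - by rewrite cf0_gact g0 y0 /x1 dg_map_gact.
  - by rewrite -(gact0 F' (f 1 x')); apply: ev_gact.
  - by eexists; apply: (ev_exps F' gE c'e); apply: evD Ege; apply: ev_ad gE c'e.
by apply: gauge_trans x1x'E => //; exists a.
Qed.

(** Maurer-Cartan elements of the source with equivalent images are
    equivalent. *)
Lemma mc_inj x x' : curv x = 0 -> curv x' = 0 ->
  gauge_equiv F' (f 1 x) (f 1 x') -> gauge_equiv F x x'.
Proof.
move=> cx cx' [b bx].
have H n : mc_inj_at n -> mc_inj_at 0 by elim: n => // n IH /mc_inj_step.
have H0 : mc_inj_at 0.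
  apply: (H (fil_len F)) => z z' y c _ _ zz' _ _ _ _ _ _.
  move/(fil_end (n := F))/eqP: zz'; rewrite subr_eq0 => /eqP ->.
  exact: gauge_refl.
apply: (H0 x x' (gact (psF F') (mono 1 b) (mono 0 (f 1 x))) (mono 1 b)) => //.
- exact: fil_top.
- exact: fil_top.
- exact: path_gact.
- apply: gact_curv => //; rewrite curv_mono0 -dg_map_curv cx dg_map0.
  by apply: psP => n; rewrite cf_mono if_same.
- by rewrite cf0_gact !cf_mono /= gact0.
- by rewrite -bx; apply: ev_gact; apply: ev_mono.
- by exists b; apply: ev_mono.
Qed.

End Morphism.

(** * Local Artinian algebras *)

Section Zorn.
Local Open Scope classical_set_scope.

(** Zorn's lemma for a nonempty family of sets closed under unions of nonempty
    chains. *)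
Lemma zorn_nonempty (T : Type) (P : set (set T)) (B0 : set T) : P B0 ->
  (forall F : set (set T), F `<=` P -> F !=set0 -> total_on F subset ->
    P (\bigcup_(X in F) X)) ->
  exists2 B, P B & forall C, P C -> B `<=` C -> C `<=` B.
Proof.
move=> PB0 chain.
have [F FP Ftot|B [PB Bmax]] := @Zorn_bigcup T [set X | X = set0 \/ P X].
  have [[X [FX PX]]|noP] := pselect (exists X, F X /\ P X).
    right; rewrite (_ : \bigcup_(X in F) X = \bigcup_(X in F `&` P) X).
      apply: chain => [Y []//||Y Z [FY _] [FZ _]]; first by exists X.
      exact: Ftot.
    apply/seteqP; split=> t [Y]; last by case=> FY _ Yt; exists Y.
    move=> FY Yt; exists Y => //; split=> //.
    by case: (FP _ FY) => // Y0; rewrite Y0 in Yt.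
  left; apply/seteqP; split=> // t [Y FY Yt]; apply: noP; exists Y; split=> //.
  by case: (FP _ FY) => // Y0; rewrite Y0 in Yt.
have max C : P C -> B `<=` C -> C `<=` B.
  move=> PC BC; apply: contrapT => nCB; apply: (Bmax C); last by right.
  by split.
case: PB => [B_0|PB]; last by exists B.
exists B0 => // C PC _; have := max C PC.
rewrite B_0 => /(_ (@sub0set _ _)) C0 t /C0 [].
Qed.

(** A vector outside a subspace is separated from it by a linear form. *)
Lemma separating_form (K : fieldType) (V : lmodType K) (S : set V) (a : V) :
  S 0 -> (forall c x y, S x -> S y -> S (c *: x + y)) -> ~ S a ->
  exists l : V -> K, [/\ forall c x y, l (c *: x + y) = c * l x + l y, l a = 1 &
    forall x, S x -> l x = 0].
Proof.
move=> S0 Slin Sa.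
(* H is maximal among the subspaces containing S but not a, hence a
   hyperplane, and l v is the coordinate of v along a modulo H. *)
pose sub (J : set V) := [/\ S `<=` J, forall c x y, J x -> J y -> J (c *: x + y) &
  ~ J a].
have [|F Fsub [X FX] Ftot|H [SH Hlin Ha] Hmax] := @zorn_nonempty V sub S.
- by split.
- split=> [x Sx|c x y [Y FY Yx] [Z FZ Zy]|[Y FY Ya]].
  + by exists X => //; case: (Fsub _ FX) => + _ _; apply.
  + have [YZ|ZY] := Ftot _ _ FY FZ.
      by exists Z => //; case: (Fsub _ FZ) => _ + _; apply=> //; apply: YZ.
    by exists Y => //; case: (Fsub _ FY) => _ + _; apply=> //; apply: ZY.
  + by case: (Fsub _ FY).
have H0 : H 0 by exact: SH.
have HZ c x : H x -> H (c *: x) by move=> Hx; rewrite -[_ *: _]addr0; apply: Hlin.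
have HD x y : H x -> H y -> H (x + y).
  by move=> Hx Hy; rewrite -[x]scale1r; apply: Hlin.
have ex v : exists c, H (v - c *: a).
  have [Hv|nHv] := pselect (H v); first by exists 0; rewrite scale0r subr0.
  pose J := [set x | exists c, H (x - c *: v)].
  have HJ : H `<=` J by move=> x Hx; exists 0; rewrite scale0r subr0.
  have [Ja|nJa] := pselect (J a); last first.
    case: nHv; apply: (Hmax J) => //; last by exists 1; rewrite scale1r subrr.
    split=> // [x /SH /HJ //|c x y [d Hx] [e Hy]].
    exists (c * d + e); rewrite scalerDl -scalerA opprD addrACA -scalerBr.
    exact: Hlin.
  have [c Hc] := Ja; have c0 : c != 0.
    by apply/eqP => c0; apply: Ha; move: Hc; rewrite c0 scale0r subr0.
  exists c^-1; have := HZ (- c^-1) _ Hc.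
  by rewrite scalerBr !scaleNr opprK scalerA mulVf // scale1r addrC.
have uniq v c d : H (v - c *: a) -> H (v - d *: a) -> c = d.
  move=> Hc Hd; apply: contrapT => /eqP; rewrite -subr_eq0 => cd; apply: Ha.
  have := HD _ _ (HZ (-1) _ Hc) Hd.
  rewrite scaleN1r opprB addrA subrK -scalerBl => /(HZ (c - d)^-1).
  by rewrite scalerA mulVf // scale1r.
pose l v := sval (cid (ex v)).
have lP v : H (v - l v *: a) by apply: svalP (cid (ex v)).
exists l; split.
- move=> c x y; apply: (uniq _ _ _ (lP _)).
  by rewrite scalerDl -scalerA opprD addrACA -scalerBr; apply: Hlin.
- by apply: (uniq _ _ _ (lP _)); rewrite scale1r subrr.
- by move=> x Sx; apply: (uniq _ _ _ (lP _)); rewrite scale0r subr0; apply: SH.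
Qed.

End Zorn.

Section ArtinianPowers.
Local Open Scope classical_set_scope.
Variables (K : fieldType) (A : artAlg K).
Local Notation m := (@art_max K A).

(** 1 - y is invertible for y in the maximal ideal: otherwise, it is contained in
    some maximal ideal, which can only be m. *)
Lemma local_unit (y : A) : m y -> exists z, (1 - y) * z = 1.
Proof.
move=> my; apply: contrapT => nz.
pose P (J : set A) := [/\ ideal J, J (1 - y) & ~ J 1].
have [|F FP [X FX] Ftot|M [Mid M1y M1] Mmax] := @zorn_nonempty A P
    [set x | exists z, x = (1 - y) * z].
- split; last by case=> z z1; apply: nz; exists z.
    split=> [|_ _ [z ->] [t ->]|c _ [z ->]]; first by exists 0; rewrite mulr0.
      by exists (z + t); rewrite mulrDr.
    by exists (c * z); rewrite mulrCA.
  by exists 1; rewrite mulr1.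
- split; last by case=> Y FY; case: (FP _ FY).
    split=> [|x t [Y FY Yx] [Z FZ Zy]|c x [Y FY Yx]].
    + by exists X => //; case: (FP _ FX) => -[].
    + have [YZ|ZY] := Ftot _ _ FY FZ.
        exists Z => //; case: (FP _ FZ) => -[_ D _] _ _.
        by apply: D => //; apply: YZ.
      exists Y => //; case: (FP _ FY) => -[_ D _] _ _.
      by apply: D => //; apply: ZY.
    + by exists Y => //; case: (FP _ FY) => -[_ _ +] _ _; apply.
  by exists X => //; case: (FP _ FX).
have [M0 MD MM] := Mid.
suff Mm : maximal_ideal M.
  apply: M1; rewrite -(subrK y 1); apply: MD => //.
  by rewrite (art_max_uniq Mm).
split=> // [MT|J [J0 JD JM] MJ]; first by apply: M1; rewrite MT.
have [J1|nJ1] := pselect (J 1).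
  by right; apply/seteqP; split=> // x _; rewrite -[x]mulr1; apply: JM.
left; apply/seteqP; split=> //; apply: Mmax => //.
by split=> //; apply: MJ.
Qed.

(** The product of two ideals. *)
Inductive idprod (I J : set A) : set A :=
  | Idprod0 : idprod I J 0
  | IdprodD a b c : I a -> J b -> idprod I J c -> idprod I J (a * b + c).

Lemma idprod_ideal I J : ideal I -> ideal (idprod I J).
Proof.
move=> [_ _ IM]; split=> [|x y Ix Iy|x y Iy]; first exact: Idprod0.
  elim: Ix => [|a b c Ia Jb _ IH]; first by rewrite add0r.
  by rewrite -addrA; apply: IdprodD.
elim: Iy => [|a b c Ia Jb _ IH]; first by rewrite mulr0; apply: Idprod0.
by rewrite mulrDr mulrA; apply: IdprodD => //; apply: IM.
Qed.

(** The powers of the maximal ideal; mpow k is its power of exponent k + 1. *)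
Fixpoint mpow (k : nat) : set A := if k is n.+1 then idprod m (mpow n) else m.

Lemma mpow_ideal k : ideal (mpow k).
Proof.
have mid : ideal m by case: (art_maxP A).
by case: k => // k; apply: idprod_ideal.
Qed.

Lemma mpowD k x y : mpow k x -> mpow k y -> mpow k (x + y).
Proof. by case: (mpow_ideal k) => _ + _; apply. Qed.
Lemma mpowM k x y : mpow k y -> mpow k (x * y).
Proof. by case: (mpow_ideal k) => _ _; apply. Qed.
Lemma mpow0 k : mpow k 0. Proof. by case: (mpow_ideal k). Qed.

Lemma mpow_dec k x : mpow k.+1 x -> mpow k x.
Proof.
elim=> [|a b c _ kb _ kc]; first exact: mpow0.
by apply: mpowD => //; apply: mpowM.
Qed.

Lemma mpowS k x y : m x -> mpow k y -> mpow k.+1 (x * y).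
Proof.
move=> mx ky; rewrite -[_ * _]addr0.
by apply: IdprodD => //; apply: Idprod0.
Qed.

(** The maximal ideal is nilpotent. The powers stabilize at I = m I; if I is not
    zero, there are y_n in m such that no x_n = y_0 ... y_(n-1) kills I. The
    chain of the principal ideals (x_n) stabilizes, which gives
    x_n (1 - y_n b) = 0, where 1 - y_n b is invertible. *)
Lemma mpow_nilpotent : exists N, forall x, mpow N x -> x = 0.
Proof.
have [N stab] := artP (fun k => mpow_ideal k) mpow_dec.
exists N => x0 Nx0; apply: contrapT => x0n0.
pose Q (x : A) := exists2 i, mpow N i & x * i <> 0.
have step (t : {x | Q x}) : exists y, m y /\ Q (sval t * y).
  case: t => x [i Ni xi] /=; apply: contrapT => noy; apply: xi.
  have : mpow N.+1 i by rewrite stab.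
  elim=> [|a b c ma Nb _ IH]; first by rewrite mulr0.
  rewrite mulrDr IH addr0 mulrA; apply: contrapT => xab.
  by apply: noy; exists a; split=> //; exists b.
pose next t : {x | Q x} := exist _ _ (proj2 (svalP (cid (step t)))).
have Q1 : Q 1 by exists x0; rewrite // mul1r.
pose u n := iter n next (exist _ 1 Q1).
have uS n : exists2 y, m y & sval (u n.+1) = sval (u n) * y.
  by exists (sval (cid (step (u n)))) => //; case: (svalP (cid (step (u n)))).
pose J n := [set x | exists b, x = sval (u n) * b].
have [n|n x [b ->]|n stabJ] := artP (I := J).
- split=> [|_ _ [b ->] [c ->]|c _ [b ->]]; first by exists 0; rewrite mulr0.
    by exists (b + c); rewrite mulrDr.
  by exists (c * b); rewrite mulrCA.
- by have [y _ ->] := uS n; exists (y * b); rewrite mulrA.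
have : J n.+1 (sval (u n)) by rewrite stabJ //; exists 1; rewrite mulr1.
have [y my uSn] := uS n; case=> b; rewrite uSn -mulrA => un.
have [z yz] : exists z, (1 - y * b) * z = 1.
  by apply: local_unit; rewrite mulrC; apply: (mpowM (k := 0)).
have un0 : sval (u n) = 0.
  by rewrite -[LHS]mulr1 -yz mulrA mulrBr mulr1 -un subrr mul0r.
by case: (svalP (u n)) => i _; rewrite un0 mul0r.
Qed.

End ArtinianPowers.
Arguments mpow {K A} k _ : simpl never.

(** * The dgla of L tensored with the maximal ideal of A *)

(** All that is used of the spaces L^i (x) m_A: they are spanned by the pure
    tensors [tmt], on which the differential [tmd], the bracket [tmb] and the
    contractions [tmc] with linear forms on m_A have the expected values. *)
Record tmodel (K : fieldType) (L : dgla K) (A : artAlg K) := TModel {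
  tm :> int -> lmodType K;
  tmt : forall i, L i -> maxid A -> tm i;
  tmt_linear_l : forall i a, linear (fun x => @tmt i x a);
  tmt_linear_r : forall i x, linear (@tmt i x);
  tm_ind : forall i (P : tm i -> Prop), (forall x a, P (tmt x a)) ->
    (forall s t, P s -> P t -> P (s + t)) -> forall t, P t;
  tmd : forall i j : int, i + 1 = j -> tm i -> tm j;
  tmd_linear : forall (i j : int) (e : i + 1 = j), linear (tmd e);
  tmd_t : forall (i j : int) (e : i + 1 = j) x a,
    tmd e (tmt x a) = tmt (ddiff e x) a;
  tmb : forall i j k : int, i + j = k -> tm i -> tm j -> tm k;
  tmb_linear_l : forall (i j k : int) (e : i + j = k) v,
    linear (fun u => tmb e u v);
  tmb_linear_r : forall (i j k : int) (e : i + j = k) u, linear (tmb e u);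
  tmb_t : forall (i j k : int) (e : i + j = k) x a y b,
    tmb e (tmt x a) (tmt y b) = tmt (dbr e x y) (maxid_mul a b);
  tmc : forall i, (maxid A -> K) -> tm i -> L i;
  tmc_linear : forall i (l : maxid A -> K),
    (forall c x y, l (c *: x + y) = c * l x + l y) -> linear (@tmc i l);
  tmc_t : forall i (l : maxid A -> K) x a,
    (forall c x y, l (c *: x + y) = c * l x + l y) ->
    tmc l (@tmt i x a) = l a *: x
}.

Arguments tmt {K L A} t {i} x a : rename.
Arguments tmd {K L A} t {i j} e x : rename.
Arguments tmb {K L A} t {i j k} e u v : rename.
Arguments tmc {K L A t i} l x : rename.
Arguments tmt_linear_l {K L A} t {i} a c x y : rename.
Arguments tmt_linear_r {K L A} t {i} x c a b : rename.
Arguments tmd_linear {K L A} t {i j} e c x y : rename.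
Arguments tmb_linear_l {K L A} t {i j k} e v c x y : rename.
Arguments tmb_linear_r {K L A} t {i j k} e u c x y : rename.
Arguments tmc_linear {K L A} t {i l} H c x y : rename.

Section TensorDgla.
Variables (K : fieldType) (L : dgla K) (A : artAlg K) (T : tmodel L A).

Section Pure.
Variable i : int.
Lemma tmtDl x y a : tmt T (x + y : L i) a = tmt T x a + tmt T y a.
Proof. by case: (linear_morph (tmt_linear_l T (i := i) a)). Qed.
Lemma tmtNl x a : tmt T (- x : L i) a = - tmt T x a.
Proof. by case: (linear_morph (tmt_linear_l T (i := i) a)). Qed.
Lemma tmtZl c x a : tmt T (c *: x : L i) a = c *: tmt T x a.
Proof. by case: (linear_morph (tmt_linear_l T (i := i) a)). Qed.
Lemma tmt0l a : tmt T (0 : L i) a = 0.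
Proof. by case: (linear_morph (tmt_linear_l T (i := i) a)). Qed.
Lemma tmtDr (x : L i) a b : tmt T x (a + b) = tmt T x a + tmt T x b.
Proof. by case: (linear_morph (tmt_linear_r T x)). Qed.
Lemma tmtNr (x : L i) a : tmt T x (- a) = - tmt T x a.
Proof. by case: (linear_morph (tmt_linear_r T x)). Qed.
Lemma tmtZr c (x : L i) a : tmt T x (c *: a) = c *: tmt T x a.
Proof. by case: (linear_morph (tmt_linear_r T x)). Qed.
Lemma tmt0r (x : L i) : tmt T x 0 = 0.
Proof. by case: (linear_morph (tmt_linear_r T x)). Qed.
End Pure.

Section Diff.
Variables (i j : int) (e : i + 1 = j).
Lemma tmd0 : tmd T e 0 = 0.
Proof. by case: (linear_morph (tmd_linear T e)). Qed.
Lemma tmdD u v : tmd T e (u + v) = tmd T e u + tmd T e v.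
Proof. by case: (linear_morph (tmd_linear T e)). Qed.
End Diff.

Section Bracket.
Variables (i j k : int) (e : i + j = k).
Lemma tmb0l v : tmb T e 0 v = 0.
Proof. by case: (linear_morph (tmb_linear_l T e v)). Qed.
Lemma tmbDl u u' v : tmb T e (u + u') v = tmb T e u v + tmb T e u' v.
Proof. by case: (linear_morph (tmb_linear_l T e v)). Qed.
Lemma tmbDr u v v' : tmb T e u (v + v') = tmb T e u v + tmb T e u v'.
Proof. by case: (linear_morph (tmb_linear_r T e u)). Qed.
End Bracket.

Fact tmb_skew (i j k : int) (e : i + j = k) (e' : j + i = k) u v :
  tmb T e u v = - ((-1) ^+ absz (i * j) *: tmb T e' v u).
Proof.
elim/(@tm_ind _ _ _ T): u => [x a|u u' IH IH']; last first.
  by rewrite tmbDl tmbDr IH IH' scalerDr opprD.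
elim/(@tm_ind _ _ _ T): v => [y b|v v' IH IH']; last first.
  by rewrite tmbDl tmbDr IH IH' scalerDr opprD.
rewrite !tmb_t (dbr_skew e e') tmtNl tmtZl.
by congr (- (_ *: tmt T _ _)); apply: val_inj; apply: mulrC.
Qed.

Fact tmb_jacobi (i j k ij jk ik l : int)
      (eij : i + j = ij) (ejk : j + k = jk) (eik : i + k = ik)
      (e1 : i + jk = l) (e2 : ij + k = l) (e3 : j + ik = l) x y z :
    tmb T e1 x (tmb T ejk y z) =
    tmb T e2 (tmb T eij x y) z
    + (-1) ^+ absz (i * j) *: tmb T e3 y (tmb T eik x z).
Proof.
elim/(@tm_ind _ _ _ T): x => [x a|x x' IH IH']; last first.
  by rewrite !(tmbDl, tmbDr) IH IH' scalerDr addrACA.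
elim/(@tm_ind _ _ _ T): y => [y b|y y' IH IH']; last first.
  by rewrite !(tmbDl, tmbDr) IH IH' scalerDr addrACA.
elim/(@tm_ind _ _ _ T): z => [z c|z z' IH IH']; last first.
  by rewrite !(tmbDl, tmbDr) IH IH' scalerDr addrACA.
rewrite !tmb_t (dbr_jacobi eij ejk eik e1 e2 e3) tmtDl tmtZl.
congr (tmt T _ _ + _ *: tmt T _ _); apply: val_inj => /=; first exact: mulrA.
exact: mulrCA.
Qed.

Fact tmd_tmd (i j k : int) (e : i + 1 = j) (e' : j + 1 = k) x :
  tmd T e' (tmd T e x) = 0.
Proof.
elim/(@tm_ind _ _ _ T): x => [x a|x x' IH IH'].
  by rewrite !tmd_t ddiff_ddiff tmt0l.
by rewrite !tmdD IH IH' addr0.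
Qed.

Fact tmd_tmb (i j k i' j' k' : int) (e : i + j = k)
      (ei : i + 1 = i') (ej : j + 1 = j') (ek : k + 1 = k')
      (e1 : i' + j = k') (e2 : i + j' = k') x y :
    tmd T ek (tmb T e x y) =
    tmb T e1 (tmd T ei x) y + (-1) ^+ absz i *: tmb T e2 x (tmd T ej y).
Proof.
elim/(@tm_ind _ _ _ T): x => [x a|x x' IH IH']; last first.
  by rewrite !(tmbDl, tmdD) IH IH' scalerDr addrACA.
elim/(@tm_ind _ _ _ T): y => [y b|y y' IH IH']; last first.
  by rewrite !(tmbDr, tmdD) IH IH' scalerDr addrACA.
by rewrite !(tmb_t, tmd_t) (ddiff_dbr e ei ej ek e1 e2) tmtDl tmtZl.
Qed.

(** The dgla with components L^i (x) m_A. *)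
Definition tdgla : dgla K :=
  DGLA (@tmb_linear_l _ _ _ T) (@tmb_linear_r _ _ _ T) tmb_skew tmb_jacobi
    (@tmd_linear _ _ _ T) tmd_tmd tmd_tmb.

(** The filtration of L^i (x) m_A by the images of the L^i (x) m_A^(k + 1). *)
Inductive tfil (k : nat) (i : int) : T i -> Prop :=
  | Tfil0 : tfil k 0
  | TfilD x a t : mpow k (maxid_val a) -> tfil k t -> tfil k (tmt T x a + t).

Lemma tfil_tmt k i (x : L i) (a : maxid A) :
  mpow k (maxid_val a) -> tfil k (tmt T x a).
Proof.
by move=> ka; rewrite -[tmt _ _ _]addr0; apply: TfilD => //; apply: Tfil0.
Qed.

Lemma tfilD k i (s t : T i) : tfil k s -> tfil k t -> tfil k (s + t).
Proof.
elim=> [|x a u ka _ IH] kt; first by rewrite add0r.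
by rewrite -addrA; apply: TfilD => //; apply: IH.
Qed.

Fact tfilP k i c (x y : T i) : tfil k x -> tfil k y -> tfil k (c *: x + y).
Proof.
elim=> [|v a u ka _ IH] ky; first by rewrite scaler0 add0r.
by rewrite scalerDr -tmtZl -addrA; apply: TfilD => //; apply: IH.
Qed.

Fact tfil_top i (x : T i) : tfil 0 x.
Proof.
elim/(@tm_ind _ _ _ T): x => [x a|x y]; last exact: tfilD.
by apply: tfil_tmt; apply/asboolP; apply: (maxid_valP a).
Qed.

Fact tfil_dec k i (x : T i) : tfil k.+1 x -> tfil k x.
Proof.
elim=> [|v a u ka _ IH]; first exact: Tfil0.
by apply: TfilD => //; apply: mpow_dec.
Qed.

Fact tfil_tmd k i j (e : i + 1 = j) (x : T i) : tfil k x -> tfil k (tmd T e x).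
Proof.
elim=> [|v a u ka _ IH]; first by rewrite tmd0; apply: Tfil0.
by rewrite tmdD tmd_t; apply: TfilD.
Qed.

Fact tfil_tmb k i j l (e : i + j = l) (x : T i) (y : T j) :
  tfil k x -> tfil k.+1 (tmb T e x y).
Proof.
elim=> [|v a u ka _ IH]; first by rewrite tmb0l; apply: Tfil0.
rewrite tmbDl; apply: tfilD IH.
elim/(@tm_ind _ _ _ T): y => [w b|y y' IH IH']; last by rewrite tmbDr; apply: tfilD.
rewrite tmb_t; apply: tfil_tmt => /=; rewrite mulrC; apply: mpowS => //.
by apply/asboolP; apply: (maxid_valP b).
Qed.

(** A step at which the powers of the maximal ideal vanish. *)
Definition art_len : nat := sval (cid (mpow_nilpotent A)).

Fact tfil_end i (x : T i) : tfil art_len x -> x = 0.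
Proof.
elim=> // v a u ka _ ->; rewrite addr0 (_ : a = 0) ?tmt0r //.
by apply: val_inj; apply: (svalP (cid (mpow_nilpotent A))).
Qed.

Definition tnilfilt : nilfilt tdgla :=
  @NilFilt K tdgla (fun k i => @tfil k i) art_len tfil_top (fun k i => @Tfil0 k i)
    tfilP tfil_dec tfil_tmd tfil_tmb tfil_end.

(** ** Splitting the graded pieces of the filtration *)

Lemma maxid_mpow0 k : mpow k (maxid_val (0 : maxid A)).
Proof. by rewrite (erefl : maxid_val (0 : maxid A) = 0); apply: mpow0. Qed.

(** A finite list of pairs of a vector a of m_A^(k + 1) and of a linear form on
    m_A vanishing on m_A^(k + 2). It defines an operator of finite rank on m_A,
    and by extension of scalars on L^i (x) m_A. *)
Definition good_pairs (k : nat) (s : seq (maxid A * (maxid A -> K))) :=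
  foldr (fun p P => [/\ mpow k (maxid_val p.1),
    (forall c x y, p.2 (c *: x + y) = c * p.2 x + p.2 y),
    (forall b, mpow k.+1 (maxid_val b) -> p.2 b = 0) & P]) True s.

Definition pair_op (s : seq (maxid A * (maxid A -> K))) (b : maxid A) : maxid A :=
  \sum_(p <- s) p.2 b *: p.1.

Definition tpair_op (s : seq (maxid A * (maxid A -> K))) i (t : T i) : T i :=
  \sum_(p <- s) tmt T (tmc p.2 t) p.1.

Section GoodPairs.
Variables (k : nat) (s : seq (maxid A * (maxid A -> K))).
Hypothesis gs : good_pairs k s.

Lemma pair_op_linear c x y : pair_op s (c *: x + y) = c *: pair_op s x + pair_op s y.
Proof.
move: gs; rewrite /pair_op; elim: s => [|p r IH] /=.
  by rewrite !big_nil scaler0 addr0.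
case=> _ pL _ /IH E; rewrite !big_cons E pL scalerDl scalerDr scalerA.
by rewrite addrACA.
Qed.

Lemma pair_op_mpow b : mpow k (maxid_val (pair_op s b)).
Proof.
move: gs; rewrite /pair_op; elim: s => [|p r IH] /=.
  by move=> _; rewrite big_nil; apply: maxid_mpow0.
case=> kp _ _ /IH H; rewrite big_cons /=; apply: mpowD => //.
by rewrite -mulr_algl; apply: mpowM.
Qed.

Lemma pair_op0 b : mpow k.+1 (maxid_val b) -> pair_op s b = 0.
Proof.
move=> kb; move: gs; rewrite /pair_op; elim: s => [|p r IH] /=.
  by rewrite big_nil.
by case=> _ _ p0 /IH H; rewrite big_cons H p0 // scale0r addr0.
Qed.

Lemma tpair_op_t i (x : L i) a : tpair_op s (tmt T x a) = tmt T x (pair_op s a).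
Proof.
move: gs; rewrite /pair_op /tpair_op; elim: s => [|p r IH] /=.
  by rewrite !big_nil tmt0r.
by case=> _ pL _ /IH H; rewrite !big_cons H tmc_t // tmtDr tmtZl tmtZr.
Qed.

Lemma tpair_opD i (x y : T i) : tpair_op s (x + y) = tpair_op s x + tpair_op s y.
Proof.
move: gs; rewrite /tpair_op; elim: s => [|p r IH] /=.
  by rewrite !big_nil addr0.
case=> _ pL _ /IH H; rewrite !big_cons H.
by have [_ -> _ _] := linear_morph (tmc_linear T pL (i := i)); rewrite tmtDl addrACA.
Qed.

Lemma tpair_op0 i : tpair_op s (0 : T i) = 0.
Proof.
have := tpair_op_t (0 : L i) 0; rewrite pair_op0 ?tmt0r //; exact: maxid_mpow0.
Qed.

End GoodPairs.

Lemma maxid_mpowB k (a b : maxid A) : mpow k (maxid_val a) ->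
  mpow k (maxid_val b) -> mpow k (maxid_val (a - b)).
Proof.
by move=> ka kb; apply: mpowD => //; rewrite /= -mulN1r; apply: mpowM.
Qed.

(** Any finite list of vectors of m_A^(k + 1) is fixed, modulo m_A^(k + 2), by
    the operator of some list of good pairs. *)
Lemma good_pairsP k (l : seq (maxid A)) :
  foldr (fun b P => mpow k (maxid_val b) /\ P) True l ->
  exists2 s, good_pairs k s &
    foldr (fun b P => mpow k.+1 (maxid_val (b - pair_op s b)) /\ P) True l.
Proof.
elim: l => [_|b l IH [kb /IH [s gs sl]]]; first by exists [::].
have kb' : mpow k (maxid_val (b - pair_op s b)).
  by apply: maxid_mpowB => //; apply: pair_op_mpow.
have [|nkb] := pselect (mpow k.+1 (maxid_val (b - pair_op s b))).
  by exists s.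
(* The new pair corrects the operator on b, and the new form vanishes on the
   vectors already fixed. *)
have [|c x y kx ky|l' [l'L l'b l'0]] := separating_form
    (S := fun x : maxid A => mpow k.+1 (maxid_val x)) _ _ nkb.
- exact: maxid_mpow0.
- apply: mpowD => //; rewrite -[X in mpow _ X]/(c *: maxid_val x) -mulr_algl.
  exact: mpowM.
exists ((b - pair_op s b, fun v => l' (v - pair_op s v)) :: s).
  split=> //= [c x y|v kv].
    by rewrite (pair_op_linear gs) opprD addrACA -scalerBr l'L.
  by rewrite (pair_op0 gs) // subr0; apply: l'0.
have opE v : pair_op ((b - pair_op s b, fun v => l' (v - pair_op s v)) :: s) v =
    l' (v - pair_op s v) *: (b - pair_op s b) + pair_op s v.
  by rewrite /pair_op big_cons.
split; first by rewrite opE l'b scale1r subrK subrr; apply: maxid_mpow0.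
move: sl; elim: (l) => //= v r IHr [kv /IHr]; split=> //.
by rewrite opE l'0 // scale0r add0r.
Qed.

(** Every element of the filtration is recovered, modulo the next step, from
    finitely many of its contractions. *)
Lemma tfil_split k i (t : T i) : tfil k t ->
  exists2 s, good_pairs k s & tfil k.+1 (t - tpair_op s t).
Proof.
move=> kt.
suff [l kl H] : exists2 l, foldr (fun b P => mpow k (maxid_val b) /\ P) True l &
    forall s, good_pairs k s ->
    foldr (fun b P => mpow k.+1 (maxid_val (b - pair_op s b)) /\ P) True l ->
    tfil k.+1 (t - tpair_op s t).
  by have [s gs /(H _ gs)] := good_pairsP kl; exists s.
elim: kt => [|x a u ka _ [l kl H]].
  exists [::] => // s gs _; rewrite (tpair_op0 gs) subr0; exact: Tfil0.
exists (a :: l) => // s gs /= [kas /(H s gs) Hu].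
rewrite (tpair_opD gs) opprD addrACA; apply: tfilD => //.
by rewrite (tpair_op_t gs) -tmtNr -tmtDr; apply: tfil_tmt.
Qed.

Lemma tmc_tmd i j (e : i + 1 = j) (l : maxid A -> K) (t : T i) :
  (forall c x y, l (c *: x + y) = c * l x + l y) ->
  tmc l (tmd T e t) = ddiff e (tmc l t).
Proof.
move=> lL; have [_ lD _ _] := linear_morph (tmc_linear T lL (i := i)).
have [_ lD' _ _] := linear_morph (tmc_linear T lL (i := j)).
elim/(@tm_ind _ _ _ T): t => [x a|x y IHx IHy].
  by rewrite tmd_t !tmc_t // ddiffZ.
by rewrite tmdD lD' IHx IHy lD ddiffD.
Qed.

Lemma tmc_tfil k i (l : maxid A -> K) (t : T i) :
  (forall c x y, l (c *: x + y) = c * l x + l y) ->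
  (forall b, mpow k (maxid_val b) -> l b = 0) -> tfil k t -> tmc l t = 0.
Proof.
move=> lL l0; have [lz lD _ _] := linear_morph (tmc_linear T lL (i := i)).
by elim=> [//|x a u ka _ IH]; rewrite lD IH tmc_t // l0 // scale0r addr0.
Qed.

End TensorDgla.

(** ** The graded pieces of the morphism induced by a quasi-isomorphism *)

Section Cohomology.
Variables (K : fieldType) (L N : dgla K) (f : dglaHom L N).
Hypothesis qis : quasi_isomorphism f.

Lemma ddiff_degree (M : dgla K) h h' i (e : h + 1 = i) (e' : h' + 1 = i) (y : M h) :
  exists y' : M h', ddiff e' y' = ddiff e y.
Proof.
have hh' : h = h' by apply: (addIr 1); rewrite e e'.
by case: _ / hh' in e' *; exists y; rewrite (eq_irrelevance e e').
Qed.

Lemma coh_cocycle (M : dgla K) i j (e1 : i + 1 = j) (z : M i) :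
  ddiff e1 z = 0 -> exists c : cocycle M i, cocycle_val c = z.
Proof.
by case: _ / e1 => dz; exists (@Cocycle K M i z (introT eqP dz)).
Qed.

Lemma cocycle_diff (M : dgla K) i j (e1 : i + 1 = j) (c : cocycle M i) :
  ddiff e1 (cocycle_val c) = 0.
Proof. by case: _ / e1; exact/eqP/(cocycle_valP c). Qed.

(** The two following lemmas express that f is injective and surjective in
    cohomology, in terms of cocycles and coboundaries. *)
Lemma coh_inj h i j (e0 : h + 1 = i) (e1 : i + 1 = j) (z : L i) (w : N h) :
  ddiff e1 z = 0 -> f i z = ddiff e0 w -> exists u, z = ddiff e0 u.
Proof.
move=> /coh_cocycle [c <-] fcw.
have [w' w'w] := ddiff_degree e0 (subrK 1 i) w.
have : coh_class c = coh_class (0 : cocycle L i).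
  apply: (bij_inj (qis i)); rewrite !coh_map_class.
  apply/quotmod_piP/asboolP; exists w'; rewrite w'w -fcw /=.
  by rewrite dg_map0 subr0.
move/quotmod_piP/asboolP => [u]; rewrite subr0 => uc.
have [u' u'u] := ddiff_degree (subrK 1 i) e0 u.
by exists u'; rewrite u'u.
Qed.

Lemma coh_surj h i j (e0 : h + 1 = i) (e1 : i + 1 = j) (z : N i) :
  ddiff e1 z = 0 -> exists x u, ddiff e1 x = 0 /\ z = f i x + ddiff e0 u.
Proof.
move=> /coh_cocycle [c <-]; have [g _ gK] := qis i.
pose x := quotmod_repr (g (coh_class c)).
have : coh_class c = coh_class (cocycle_map f x) by rewrite -[LHS]gK.
move/quotmod_piP/asboolP => [u uc].
have [u' u'u] := ddiff_degree (subrK 1 i) e0 u.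
exists (cocycle_val x), u'; split; first exact: cocycle_diff.
by rewrite u'u uc /= addrC subrK.
Qed.

(** F is the morphism induced by f on the tensor products. *)
Variables (A : artAlg K) (T : tmodel L A) (T' : tmodel N A).
Variable F : dglaHom (tdgla T) (tdgla T').
Hypothesis F_t : forall i (x : L i) a, F i (tmt T x a) = tmt T' (f i x) a.

Lemma tmap_fil k i (x : T i) : tfil k x -> tfil k (F i x : T' i).
Proof.
elim=> [|v a u ka _ IH]; first by rewrite (dg_map0 F); apply: Tfil0.
by rewrite (dg_mapD F) F_t; apply: TfilD.
Qed.

Lemma tmc_tmap i (l : maxid A -> K) (t : T i) :
  (forall c x y, l (c *: x + y) = c * l x + l y) ->
  tmc l (F i t : T' i) = f i (tmc l t).
Proof.
move=> lL; have [_ lD _ _] := linear_morph (tmc_linear T lL (i := i)).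
have [_ lD' _ _] := linear_morph (tmc_linear T' lL (i := i)).
elim/(@tm_ind _ _ _ T): t => [x a|x y IHx IHy].
  by rewrite F_t !tmc_t // dg_mapZ.
by rewrite (dg_mapD F) lD' IHx IHy lD dg_mapD.
Qed.

(** The contractions of z are cocycles with exact images, so that they are exact,
    and so is z modulo the next step. *)
Lemma tmap_gr_injective h i j (e0 : h + 1 = i) (e1 : i + 1 = j) :
  gr_injective F (tnilfilt T) (tnilfilt T') e0 e1.
Proof.
move=> k z w kz dz kw fzw; have [s gs zs] := tfil_split kz.
suff [u ku us] : exists2 u : T h, tfil k u & tmd T e0 u = tpair_op s z.
  by exists u => //; rewrite -us in zs.
rewrite /tpair_op; move: gs {zs}; elim: s => [|p s IH] /=.
  by exists 0; [exact: Tfil0|rewrite big_nil tmd0].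
case=> kp pL p0 /IH [u ku us].
have dcz : ddiff e1 (tmc p.2 z) = 0 by rewrite -tmc_tmd // (tmc_tfil _ _ dz).
have fcz : f i (tmc p.2 z) = ddiff e0 (tmc p.2 (w : T' h)).
  apply/eqP; rewrite -subr_eq0 -tmc_tmap // -tmc_tmd //.
  have [_ lD lN _] := linear_morph (tmc_linear T' pL (i := i)).
  by rewrite -lN -lD; apply/eqP; apply: (tmc_tfil pL p0 fzw).
have [v vE] := coh_inj dcz fcz.
exists (tmt T v p.1 + u); first exact: TfilD.
by rewrite big_cons tmdD tmd_t us -vE.
Qed.

Lemma tmap_gr_surjective h i j (e0 : h + 1 = i) (e1 : i + 1 = j) :
  gr_surjective F (tnilfilt T) (tnilfilt T') e0 e1.
Proof.
move=> k z kz dz; have [s gs zs] := tfil_split kz.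
suff [w [u [kw ku dw us]]] : exists (w : T i) (u : T' h),
    [/\ tfil k w, tfil k u, tmd T e1 w = 0 &
      tpair_op s (z : T' i) = (F i w : T' i) + tmd T' e0 u].
  rewrite us opprD addrA in zs; exists w, u; split=> //.
  by rewrite (_ : ddiff e1 _ = 0); [exact: Tfil0|exact: dw].
rewrite /tpair_op; move: gs {zs}; elim: s => [|p s IH] /=.
  exists 0, 0; rewrite big_nil !tmd0 (dg_map0 F) addr0.
  by split=> //; apply: Tfil0.
case=> kp pL p0 /IH [w [u [kw ku dw us]]].
have dcz : ddiff e1 (tmc p.2 (z : T' i)) = 0.
  by rewrite -tmc_tmd // (tmc_tfil _ _ dz).
have [x [v [dx zE]]] := coh_surj e0 dcz.
exists (tmt T x p.1 + w), (tmt T' v p.1 + u); split; try exact: TfilD.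
  by rewrite tmdD tmd_t dx dw tmt0l addr0.
by rewrite big_cons us zE (dg_mapD F) F_t tmdD tmd_t tmtDl addrACA.
Qed.

End Cohomology.
Arguments tmap_gr_injective {K L N f} qis {A T T' F} F_t {h i j} e0 e1.
Arguments tmap_gr_surjective {K L N f} qis {A T T' F} F_t {h i j} e0 e1.

(** ** Contractions of tensors *)

Section TensorInduction.
Variables (K : fieldType) (V W : lmodType K).

Lemma tensor_ind (P : tensor V W -> Prop) : (forall v w, P (tens v w)) ->
  (forall s t, P s -> P t -> P (s + t)) -> forall t, P t.
Proof.
move=> Pt PD t; rewrite [t]tensorE; elim/big_rec: _ => [|p s _ Ps].
  have [<- _ _ _] := linear_morph (@tens_linear_l K V W 0); exact: Pt.
have [_ _ _ <-] := linear_morph (@tens_linear_l K V W p.2).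
exact: PD.
Qed.

(** The contraction of a tensor with a linear form on its right factor. *)
Definition contr (l : W -> K) : tensor V W -> V :=
  tensor_lift (fun v w => l w *: v).

Variable l : W -> K.
Hypothesis lL : forall c x y, l (c *: x + y) = c * l x + l y.

Fact contr_bilinear : bilinear_fun (fun (v : V) w => l w *: v).
Proof.
split=> [w|v] c x y; first by rewrite scalerDr !scalerA mulrC.
by rewrite lL scalerDl scalerA.
Qed.

Lemma contr_linear : linear (contr l).
Proof. exact: tensor_lift_linear contr_bilinear. Qed.

Lemma contr_tens v w : contr l (tens v w) = l w *: v.
Proof. exact: tensor_lift_tens contr_bilinear. Qed.

End TensorInduction.

(** The actual tensor products L^i (x) m_A. *)
Definition lm_model (K : fieldType) (L : dgla K) (A : artAlg K) : tmodel L A :=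
  @TModel K L A (Lm L A)
    (fun i => @tens K (L i) (maxid A))
    (fun i => @tens_linear_l K (L i) (maxid A))
    (fun i => @tens_linear_r K (L i) (maxid A))
    (fun i => @tensor_ind K (L i) (maxid A))
    (@tdiff K L A)
    (fun i j e => tensor_map_linear (ddiff_linear e) (fun c x y => erefl))
    (fun i j e => tensor_map_tens (ddiff_linear e) (fun c x y => erefl))
    (@tbr K L A) (@tbr_linear_l K L A) (@tbr_linear_r K L A) (@tbr_tens K L A)
    (fun i => @contr K (L i) (maxid A))
    (fun i l lL => @contr_linear K (L i) (maxid A) l lL)
    (fun i l x a lL => @contr_tens K (L i) (maxid A) l lL x a).

(** * The deformation functor *)

Notation lm_dgla L A := (tdgla (lm_model L A)).
Notation lm_filt L A := (tnilfilt (lm_model L A)).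

Lemma sval_inj (T : Type) (P : T -> Prop) : injective (@sval T P).
Proof.
case=> [x p] [y q] /= xy; case: _ / xy q => q.
by congr exist; apply: Prop_irrelevance.
Qed.

Section Deformations.
Variables (K : fieldType) (char0 : [pchar K] =i pred0).

Section Classes.
Variables (L : dgla K) (A : artAlg K).


(** The gauge action defined by an infinite sum with finite support is the
    truncated one. *)
Lemma gaugeE (a : Lm L A 0) (x : Lm L A 1) : gauge a x = gact (lm_filt L A) a x.
Proof.
pose ad1 := @ad K (lm_dgla L A) a 1.
pose v := ad1 x - d0 (a : lm_dgla L A 0).
pose h n : Lm L A 1 := (n.+1`!%:R : K)^-1 *: iter n ad1 v.
transitivity (x + \sum_(n \in [set: nat]) h n)%classic; first by [].
transitivity (x + \sum_(n < fil_len (lm_filt L A)) h n); last by [].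
congr (_ + _); rewrite (@fsbig_ord _ _ _ _ h); apply/esym/fsbig_widen => // n [_].
move=> /negP; rewrite -leqNgt => Ln; rewrite /preimage /= /h.
by rewrite /ad1 (iter_ad_eq0 (F := lm_filt L A)) // scaler0.
Qed.

(** Gauge equivalence of Maurer-Cartan elements. *)
Definition mc_equiv (x y : MC L A) :=
  gauge_equiv (lm_filt L A) (sval x) (sval y).

Lemma gauge_orbitE x y : gauge_orbit x y <-> mc_equiv x y.
Proof. by split=> -[a ay]; exists a; rewrite -ay gaugeE. Qed.

Lemma Def_classP (x y : MC L A) : Def_class x = Def_class y <-> mc_equiv x y.
Proof.
split=> [/(congr1 sval) /= xy|xy].
  by apply/gauge_orbitE; rewrite xy; apply/gauge_orbitE/gauge_refl.
apply: sval_inj; apply/funext => z; apply/propext.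
split=> /gauge_orbitE zz; apply/gauge_orbitE.
  exact: (gauge_trans char0 (gauge_sym char0 xy) zz).
exact: (gauge_trans char0 xy zz).
Qed.

Lemma Def_repr_class (x : MC L A) : mc_equiv (Def_repr (Def_class x)) x.
Proof. by apply/Def_classP; rewrite Def_reprK. Qed.

End Classes.

Section Maps.
Variables (L N : dgla K) (A B : artAlg K) (f : dglaHom L N).
Variable g : {lrmorphism A -> B}.

(** The morphism of dglas induced by f and g. *)
Definition lm_map : dglaHom (lm_dgla L A) (lm_dgla N B) :=
  @DGLAHom K (lm_dgla L A) (lm_dgla N B) (fun i => @Lm_map K L N A B f g i)
    (fun i => @Lm_map_linear K L N A B f g i)
    (fun i j k e => @Lm_map_tbr K L N A B f g i j k e)
    (fun i j e => @Lm_map_tdiff K L N A B f g i j e).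

Lemma Def_map_class (x : MC L A) :
  Def_map f g (Def_class x) = Def_class (MC_map f g x).
Proof.
apply/Def_classP; have [a ax] := Def_repr_class x.
exists (lm_map 0 a); rewrite -[sval (MC_map f g x)]/(lm_map 1 (sval x)) -ax.
by rewrite (dg_map_gact _ (lm_filt L A) (lm_filt N B)).
Qed.

End Maps.

Lemma Lm_map_id (L : dgla K) (A : artAlg K) i (u : Lm L A i) :
  Lm_map (dgla_id L) (idfun : {lrmorphism A -> A}) u = u.
Proof.
have [_ mapD _ _] := linear_morph (@Lm_map_linear K L L A A (dgla_id L) idfun i).
elim/tensor_ind: u => [x a|u v IHu IHv]; last by rewrite mapD IHu IHv.
by rewrite Lm_map_tens; congr tens; apply: val_inj.
Qed.

Lemma Lm_map_comp (L M N : dgla K) (A B C : artAlg K) (f : dglaHom L M)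
    (f' : dglaHom M N) (h : dglaHom L N) (g : {lrmorphism A -> B})
    (g' : {lrmorphism B -> C}) (k : {lrmorphism A -> C}) i (u : Lm L A i) :
  (forall x : L i, h i x = f' i (f i x)) -> (forall a, k a = g' (g a)) ->
  Lm_map h k u = Lm_map f' g' (Lm_map f g u).
Proof.
move=> hE kE; have [_ hD _ _] := linear_morph (@Lm_map_linear _ _ _ _ _ h k i).
have [_ fD _ _] := linear_morph (@Lm_map_linear _ _ _ _ _ f g i).
have [_ fD' _ _] := linear_morph (@Lm_map_linear _ _ _ _ _ f' g' i).
elim/tensor_ind: u => [x a|u v IHu IHv]; last by rewrite hD fD fD' IHu IHv.
by rewrite !Lm_map_tens hE; congr tens; apply: val_inj; apply: kE.
Qed.

Lemma Def_class_repr (L : dgla K) (A : artAlg K) (C : Def L A) :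
  exists x, C = Def_class x.
Proof. by exists (Def_repr C); rewrite Def_reprK. Qed.

Lemma Def_functor_laws (L : dgla K) : Def_functorial L.
Proof.
split; last by move=> A B g x; apply: Def_map_class.
split=> [A C|A B C g h D].
  have [x ->] := Def_class_repr C.
  rewrite [LHS](@Def_map_class L L A A (dgla_id L) idfun x).
  by congr Def_class; apply: sval_inj; apply: Lm_map_id.
have [x ->] := Def_class_repr D.
rewrite [LHS](@Def_map_class L L A C (dgla_id L) (h \o g) x).
rewrite [fmap g _](@Def_map_class L L A B (dgla_id L) g x).
rewrite [RHS](@Def_map_class L L B C (dgla_id L) h _).
by congr Def_class; apply: sval_inj; apply: Lm_map_comp.
Qed.

Lemma Def_mor_natural (L N : dgla K) (f : dglaHom L N) : natural (Def_mor f).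
Proof.
move=> A B g C; have [x ->] := Def_class_repr C.
rewrite [fmap (a := Def_functor L) g (Def_class x)](@Def_map_class L L A B
  (dgla_id L) g x).
rewrite [LHS](@Def_map_class L N B B f idfun _).
rewrite [Def_mor f (Def_class x)](@Def_map_class L N A A f idfun x).
rewrite [RHS](@Def_map_class N N A B (dgla_id N) g _).
congr Def_class; apply: sval_inj => /=.
transitivity (Lm_map f g (sval x)); first exact/esym/Lm_map_comp.
exact: Lm_map_comp.
Qed.

Section QuasiIsomorphism.
Variables (L N : dgla K) (f : dglaHom L N) (qis : quasi_isomorphism f).
Variable A : artAlg K.
Local Notation F := (lm_map f (idfun : {lrmorphism A -> A})).

Lemma lm_map_tmt i (x : L i) a :
  F i (tmt (lm_model L A) x a) = tmt (lm_model N A) (f i x) a.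
Proof.
by rewrite [LHS]Lm_map_tens; congr tens; apply: val_inj.
Qed.

Lemma lm_map_fil k i (z : lm_dgla L A i) :
  fil (lm_filt L A) k z -> fil (lm_filt N A) k (F i z).
Proof. by apply: tmap_fil => j u a; apply: lm_map_tmt. Qed.

Lemma Def_mor_inj (C D : Def L A) : Def_mor f C = Def_mor f D -> C = D.
Proof.
have [x ->] := Def_class_repr C; have [y ->] := Def_class_repr D.
move=> xy; have xE := Def_map_class f (idfun : {lrmorphism A -> A}) x.
have yE := Def_map_class f (idfun : {lrmorphism A -> A}) y.
have {}xy : mc_equiv (MC_map f (idfun : {lrmorphism A -> A}) x)
    (MC_map f (idfun : {lrmorphism A -> A}) y).
  exact/Def_classP/(etrans (esym xE) (etrans xy yE)).
apply/Def_classP.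
have cx : curv (sval x : lm_dgla L A 1) = 0 by exact: (svalP x).
have cy : curv (sval y : lm_dgla L A 1) = 0 by exact: (svalP y).
exact: (mc_inj char0 lm_map_fil (tmap_gr_injective qis lm_map_tmt _ _)
  (tmap_gr_surjective qis lm_map_tmt _ _) cx cy xy).
Qed.

Lemma Def_mor_surj (D : Def N A) : exists C : Def L A, Def_mor f C = D.
Proof.
have [y ->] := Def_class_repr D.
have cy : curv (sval y : lm_dgla N A 1) = 0 by exact: (svalP y).
have [x cx xy] := mc_surj char0 lm_map_fil (tmap_gr_injective qis lm_map_tmt _ _)
  (tmap_gr_surjective qis lm_map_tmt _ _) cy.
exists (Def_class (exist _ x cx : MC L A)).
rewrite [LHS](@Def_map_class L N A A f idfun _).
exact/Def_classP.
Qed.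

End QuasiIsomorphism.
End Deformations.

Theorem corollaryV52 (K : fieldType) (char0 : [pchar K] =i pred0)
    (L N : dgla K) (f : dglaHom L N) (qis : quasi_isomorphism f) :
  [/\ Def_functorial L,
      Def_functorial N,
      (forall (A : artAlg K) (x : MC L A),
        Def_mor f (Def_class x) =
        Def_class (MC_map f (idfun : {lrmorphism A -> A}) x)) &
      natural_isomorphism (Def_mor f)].
Proof.
split; [exact: Def_functor_laws|exact: Def_functor_laws| |].
  by move=> A x; apply: Def_map_class.
split; first exact: Def_mor_natural.
pose psi A (D : Def N A) : Def L A := sval (cid (Def_mor_surj char0 qis D)).
have psiK A : cancel (psi A) (Def_mor f (A := A)).
  by move=> D; apply: (svalP (cid (Def_mor_surj char0 qis D))).
have Kpsi A : cancel (Def_mor f (A := A)) (psi A).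
  by move=> C; apply: (Def_mor_inj char0 qis); rewrite psiK.
exists psi; split=> [A B g D|A]; last first.
  by split; [exact: Kpsi|exact: psiK].
apply: (Def_mor_inj char0 qis).
by rewrite [RHS](Def_mor_natural char0 f) !psiK.
Qed.
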